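(* For positive integers $x$, let $$S_\omega(x) := \sum_{mn \le x} \omega([m,n]),$$ where the sum is over all ordered pairs $(m,n)$ of positive integers with $mn \le x$. Then, as $x \to \infty$, $$S_\omega(x) = 2x \log x \log\log x + B x \log x + O(x \log\log x),$$ where $$B = 2\left(\gamma - 1 + \sum_p \left(\log\left(1-\frac{1}{p}\right) + \frac{1}{p} - \frac{1}{2p^2}\right)\right).$$
   Context: $[m,n]$ denotes the least common multiple of $m$ and $n$; $\omega(k)$ denotes the number of distinct prime divisors of the positive integer $k$ (so $\omega(1)=0$); $\gamma$ is the Euler-Mascheroni constant; $\sum_p$ denotes summation over all primes $p$. The variable $x$ is a positive integer. *)

(* Defs.v *)
From HB Require Import structures.
From mathcomp Require Import all_boot all_order all_algebra.
From mathcomp Require Import all_classical all_reals all_analysis.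

Set Implicit Arguments.
Unset Strict Implicit.
Unset Printing Implicit Defensive.

Import Order.TTheory GRing.Theory Num.Theory.
Import numFieldNormedType.Exports.

Definition omega (k : nat) : nat := size (primes k).

(* The bounds m, n <= x are implied by m * n <= x for positive m and n. *)
Definition S_omega (x : nat) : nat :=
  (\sum_(1 <= m < x.+1) \sum_(1 <= n < x.+1 | m * n <= x) omega (lcmn m n))%N.

Local Open Scope classical_set_scope.
Local Open Scope ring_scope.

(* [series harmonic n] is 1 + 1/2 + ... + 1/n. *)
Definition euler_gamma (R : realType) : R :=
  limn (fun n : nat => series (@harmonic R) n - ln n%:R).

Definition B_const (R : realType) : R :=
  2 * (euler_gamma R - 1
       + \big[+%R/0]_(0 <= p <oo | prime p)
           (ln (1 - p%:R^-1) + p%:R^-1 - (2 * p%:R ^+ 2)^-1)).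

(* Main.v *)
(* Since [lcm(m, n)] and [mn] have the same prime divisors, inclusion-exclusion
   on [p | m] and [p | n] gives
     S_omega(x) = sum_(p <= x) (2 D(x / p) - D(x / p^2)),
   where D(y) = sum_(m <= y) floor(y / m) = y log y + O(y). Summing over p
   reduces the theorem to Mertens' estimates for sum log p / p and for sum 1/p,
   the latter with its constant M = gamma + sum_p (log(1 - 1/p) + 1/p). That
   value of M is obtained by letting d -> 0 in sum_p p^(-1-d), evaluated once by
   the Euler product of zeta(1 + d) and once by Abel summation against the
   series sum_k 2^(-kd) / k = - log(1 - 2^(-d)). *)

Require Import Defs.
From HB Require Import structures.
From mathcomp Require Import all_boot all_order all_algebra.
From mathcomp Require Import all_classical all_reals all_analysis.
From mathcomp Require Import ring lra.

Set Implicit Arguments.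
Unset Strict Implicit.
Unset Printing Implicit Defensive.

Import Order.TTheory GRing.Theory Num.Theory.
Import numFieldNormedType.Exports.

Local Open Scope classical_set_scope.
Local Open Scope ring_scope.

(* [lra] does not treat [n.+1%:R^-1] as an atom. *)
Ltac linv :=
  repeat match goal with
  | H : is_true (@Order.le _ _ _ _) |- _ => move: H
  | H : is_true (@Order.lt _ _ _ _) |- _ => move: H
  end;
  repeat match goal with |- context [@GRing.inv ?U ?x] =>
    first [move: (@GRing.inv U x) => ? | generalize (@GRing.inv U x); intro]
  end; lra.

(** The delicate point is the value of M. The series sum_k 2^(-kd) / k is a good companion for sum_p
    p^(-1-d): its coefficients summed over 2^k <= n give a harmonic number of order log_2 n, which
    grows like log log n, as the sum of 1/p does, and brings in gamma through its definition; yet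
    the whole series is elementary. So no integral representation of gamma is needed, and the base 2
    leaves only a log log 2 that cancels. Limits in the cutoff N are taken at fixed d, with errors
    uniform in N, and d is made small only afterwards.

    The Euler product is obtained by a sieve that strikes out the multiples of one prime at a time,
    so no sum is rearranged along prime factorizations.

    In B, the -1 comes from sum_(p <= x) log p / p = log x + O(1), and the -1/(2p^2) from the terms
    D(x / p^2). The error x log log x comes from the O(x / p) in D(x / p), summed over p; every
    other error is O(x). *)

(** * Elementary bounds for logarithms and harmonic sums *)

Lemma ln_le_sub1 (R : realType) (x : R) : 0 < x -> ln x <= x - 1.
Proof. by move=> x0; have := expR_ge1Dx (ln x); rewrite lnK ?posrE//; lra. Qed.

Lemma ln_ge_1subV (R : realType) (x : R) : 0 < x -> 1 - x^-1 <= ln x.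
Proof.
move=> x0; have xV : 0 < x^-1 by rewrite invr_gt0.
by have := ln_le_sub1 xV; rewrite lnV ?posrE//; lra.
Qed.

Lemma lnB_le (R : realType) (x y : R) : 0 < x -> 0 < y -> ln y - ln x <= (y - x) / x.
Proof.
move=> x0 y0; rewrite -ln_div ?posrE//.
apply: le_trans (ln_le_sub1 (divr_gt0 y0 x0)) _.
by rewrite mulrBl divff ?gt_eqF.
Qed.

Lemma lnB_ge (R : realType) (x y : R) : 0 < x -> 0 < y -> (y - x) / y <= ln y - ln x.
Proof.
move=> x0 y0; have := lnB_le y0 x0.
have -> : (y - x) / y = - ((x - y) / y) by rewrite -mulNr opprB.
lra.
Qed.

Lemma ln_natS_le (R : realType) (n : nat) : (0 < n)%N ->
  ln n.+1%:R - ln n%:R <= n%:R^-1 :> R.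
Proof.
move=> n0; have nR : 0 < n%:R :> R by rewrite ltr0n.
apply: le_trans (lnB_le nR (ltr0Sn _ _)) _.
by rewrite -natr1 addrAC subrr add0r mul1r.
Qed.

Lemma ln_natS_ge (R : realType) (n : nat) : (0 < n)%N ->
  n.+1%:R^-1 <= ln n.+1%:R - ln n%:R :> R.
Proof.
move=> n0; have nR : 0 < n%:R :> R by rewrite ltr0n.
apply: le_trans (lnB_ge nR (ltr0Sn _ _)).
by rewrite -natr1 addrAC subrr add0r mul1r.
Qed.

Lemma ln_nat_ge0 (R : realType) (n : nat) : 0 <= ln n%:R :> R.
Proof. by case: n => [|n]; [rewrite ln0|rewrite ln_ge0// ler1n]. Qed.

Lemma ln_nat_gt0 (R : realType) (n : nat) : (1 < n)%N -> 0 < ln n%:R :> R.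
Proof. by move=> n1; rewrite ln_gt0// ltr1n. Qed.

Lemma ler_ln_nat (R : realType) (m n : nat) : (0 < m)%N -> (m <= n)%N ->
  ln m%:R <= ln n%:R :> R.
Proof.
move=> m0 mn; rewrite ler_ln ?posrE ?ltr0n ?ler_nat//.
exact: leq_trans mn.
Qed.

Lemma ln2_le1 (R : realType) : ln 2 <= 1 :> R.
Proof. by have := @ln_le_sub1 R 2 ltac:(lra); lra. Qed.

Definition harm (R : realType) (n : nat) : R := \sum_(1 <= m < n.+1) m%:R^-1.

Lemma harm0 (R : realType) : harm R 0 = 0.
Proof. by rewrite /harm big_geq. Qed.

Lemma harmS (R : realType) (n : nat) : harm R n.+1 = harm R n + n.+1%:R^-1.
Proof. by rewrite /harm big_nat_recr. Qed.

Lemma harm_ge (R : realType) (n : nat) : ln n.+1%:R <= harm R n.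
Proof.
elim: n => [|n IH]; first by rewrite harm0 ln1.
by rewrite harmS; have := @ln_natS_le R n.+1 isT; linv.
Qed.

Lemma harm_le (R : realType) (n : nat) : (0 < n)%N -> harm R n <= 1 + ln n%:R.
Proof.
elim: n => // -[|n] IH _; first by rewrite harmS harm0 ln1 invr1 add0r addr0.
by rewrite harmS; have := @ln_natS_ge R n.+1 isT; have := IH isT; linv.
Qed.

Lemma sum_ln_div_sqr_le (R : realType) (n : nat) :
  \sum_(0 <= m < n) ln m%:R / m%:R ^+ 2 <= 2 :> R.
Proof.
(* An antiderivative of ln t / t^2 is -(1 + ln t) / t. The 2 in place of 1 leaves enough room for
   each term to be at most a difference of consecutive values of [f], and [f 1 = 2] is the bound. *)
pose f (n : nat) : R := (2 + ln n%:R) / n%:R.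
suff H : forall k, \sum_(0 <= m < k.+2) ln m%:R / m%:R ^+ 2 <= 2 - f k.+1.
  have f0 k : 0 <= f k by rewrite divr_ge0// addr_ge0// ln_nat_ge0.
  case: n => [|[|k]].
  - by rewrite big_geq.
  - by rewrite big_nat1 ln0// mul0r.
  - by apply: le_trans (H k) _; rewrite gerBl f0.
elim=> [|k IH].
  by rewrite big_nat_recr//= big_nat1 ln0// ln1 !mul0r /f ln1 divr1; lra.
rewrite big_nat_recr//=.
suff : ln k.+2%:R / k.+2%:R ^+ 2 <= f k.+1 - f k.+2 by move: IH; linv.
rewrite /f.
have H := @ln_natS_le R k.+1 isT.
have L0 := @ln_nat_ge0 R k.+2.
have x1 : 1 <= k.+1%:R :> R by rewrite ler1n.
move: (ln k.+2%:R) (ln k.+1%:R) L0 H => L' L L0.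
rewrite -[k.+2%:R]natr1; move: k.+1%:R x1 => x x1 H.
have xp : 0 < x by lra.
have x1p : 0 < x + 1 by lra.
have xx1 : 0 < x * (x + 1) by rewrite mulr_gt0.
have h1 : (2 + L' - x^-1) / x <= (2 + L) / x by rewrite ler_pM2r ?invr_gt0//; linv.
apply: le_trans (lerB h1 (lexx _)).
have -> : (2 + L' - x^-1) / x - (2 + L') / (x + 1) =
    L' / (x * (x + 1)) + (2 / (x * (x + 1)) - (x * x)^-1).
  by field; rewrite !gt_eqF.
have h2 : (x * x)^-1 <= 2 / (x * (x + 1)).
  have -> : 2 / (x * (x + 1)) = (x * (x + 1) / 2)^-1 by field; rewrite !gt_eqF.
  rewrite lef_pV2 ?posrE; [nra..].
have h3 : L' / (x + 1) ^+ 2 <= L' / (x * (x + 1)).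
  by rewrite ler_wpM2l// lef_pV2 ?posrE// expr2 ?mulr_gt0// ler_pM2r//; lra.
linv.
Qed.

(** The intervals [F n - g n, F n + g n] are nested from [n0] on, and M is the supremum of their
    left ends. This gives a limit together with an explicit rate whenever [g] tends to 0. *)
Lemma telescope_dominated_cvg (R : realType) (F g : nat -> R) (n0 : nat) :
  (forall n, 0 <= g n) ->
  (forall n, (n0 <= n)%N -> `|F n.+1 - F n| <= g n - g n.+1) ->
  exists M, forall n, (n0 <= n)%N -> `|F n - M| <= g n.
Proof.
move=> g0 H.
have Hm n k : (n0 <= n)%N -> F n - g n <= F (n + k)%N - g (n + k)%N.
  move=> nn; elim: k => [|k IH]; first by rewrite addn0.
  rewrite addnS; apply: le_trans IH _.
  have := H (n + k)%N (leq_trans nn (leq_addr _ _)).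
  by rewrite ler_norml => /andP[]; lra.
have Hp n k : (n0 <= n)%N -> F (n + k)%N + g (n + k)%N <= F n + g n.
  move=> nn; elim: k => [|k IH]; first by rewrite addn0.
  rewrite addnS; apply: le_trans IH.
  have := H (n + k)%N (leq_trans nn (leq_addr _ _)).
  by rewrite ler_norml => /andP[]; lra.
pose S := [set F n - g n | n in [set n | (n0 <= n)%N]].
have ub n : (n0 <= n)%N -> ubound S (F n + g n).
  move=> nn _ [m /= mm <-].
  have h1 := Hm m n mm; have h2 := Hp n m nn.
  have := g0 (n + m)%N; rewrite addnC in h1 *; lra.
have S0 : S !=set0 by exists (F n0 - g n0); exists n0 => /=.
exists (sup S) => n nn.
have h1 : sup S <= F n + g n by apply: ge_sup => //; apply: ub.
have h2 : F n - g n <= sup S.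
  by apply: ub_le_sup; [exists (F n + g n); exact: ub | exists n].
by rewrite ler_norml; apply/andP; split; lra.
Qed.

(** * Chebyshev bound *)

Lemma dvdn_fact_prime (p n : nat) : prime p -> (p %| n`!)%N = (p <= n)%N.
Proof.
move=> pp; elim: n => [|n IH].
  by rewrite fact0 dvdn1 leqn0; case: p pp => [|[]].
rewrite factS Euclid_dvdM// IH [RHS]leq_eqVlt ltnS.
apply/orP/orP => -[]; [|by right| |by right].
  by move=> /(dvdn_leq (ltn0Sn n)); rewrite leq_eqVlt ltnS => /orP[->|->]; [left|right].
by move=> /eqP ->; left.
Qed.

Lemma big_nat_cond_widen0 (V : nmodType) (a b : nat) (P : pred nat) (F : nat -> V) :
  (a <= b)%N -> (forall n, (a <= n)%N -> P n -> F n = 0) ->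
  \sum_(0 <= n < b | P n) F n = \sum_(0 <= n < a | P n) F n.
Proof.
move=> ab F0; rewrite (big_cat_nat (leq0n a) ab)/=.
rewrite -[RHS]addr0; congr (_ + _).
by rewrite big_nat_cond big1// => n /andP[/andP[an _]]; apply: F0.
Qed.

(** [N] bounds only the prime divisors of [m], not [m] itself: the lemma is applied to factorials
    and binomial coefficients, whose primes are small. *)
Lemma ln_prod_prime (R : realType) (N m : nat) : (0 < m)%N ->
  (forall p, prime p -> (p %| m)%N -> (p <= N)%N) ->
  ln m%:R = \sum_(0 <= p < N.+1 | prime p) (logn p m)%:R * ln p%:R :> R.
Proof.
move=> m0 mN.
have E : m = (\prod_(0 <= p < (maxn N m).+1 | prime p) p ^ logn p m)%N.
  rewrite -{1}(part_pnat_id (pnat_pi m0)).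
  rewrite (@widen_partn (maxn N m)) ?leq_maxr//.
  rewrite [RHS]big_mkcond/= [LHS]big_mkcond; apply: eq_bigr => p _.
  rewrite mem_primes; case: (prime p) => //=; rewrite m0/=.
  by case: ifP => // pm; rewrite lognE pm !andbF.
have L0 (s : seq nat) : ln (\prod_(p <- s | prime p) p ^ logn p m)%N%:R =
   \sum_(p <- s | prime p) (logn p m)%:R * ln p%:R :> R.
  elim: s => [|p s IH]; first by rewrite !big_nil ln1.
  rewrite !big_cons; case: ifP => // pp.
  have p0 := prime_gt0 pp.
  rewrite natrM lnM ?posrE ?ltr0n ?expn_gt0 ?p0//; last first.
    by apply: prodn_cond_gt0 => q qq; rewrite expn_gt0 prime_gt0.
  by rewrite IH natrX lnXn ?ltr0n// mulr_natl.
rewrite {1}E L0; apply: big_nat_cond_widen0 => [|p Np pp].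
  by rewrite ltnS leq_maxl.
rewrite lognE pp m0/=; case: ifP => [pm|_]; last by rewrite mul0r.
by have := mN _ pp pm; rewrite leqNgt Np.
Qed.

Definition theta (R : realType) (n : nat) : R :=
  \sum_(0 <= p < n.+1 | prime p) ln p%:R.

Lemma theta_mono (R : realType) (m n : nat) : (m <= n)%N -> theta R m <= theta R n.
Proof.
move=> mn; rewrite /theta [leRHS](@big_cat_nat _ _ _ m.+1)//= lerDl.
by apply: sumr_ge0 => p _; apply: ln_nat_ge0.
Qed.

(* Every prime in (n, 2n] divides the central binomial coefficient, which is
   at most 4^n. *)
Lemma theta_double (R : realType) (n : nat) :
  theta R n.*2 - theta R n <= n.*2%:R.
Proof.
set b := 'C(n.*2, n).
have b0 : (0 < b)%N by rewrite bin_gt0 -addnn leq_addr.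
have bE : (b * (n`! * n`!) = n.*2`!)%N.
  by have := @bin_fact n.*2 n; rewrite /b -addnn addnK => ->//; exact: leq_addr.
have b2 : (b <= 2 ^ n.*2)%N.
  have := @Pascal 1 1 n.*2; rewrite addn1 => ->.
  rewrite (bigD1 (inord n))//= inordK; last by rewrite ltnS -addnn leq_addr.
  by rewrite !exp1n !muln1 leq_addr.
have lb : ln b%:R = \sum_(0 <= p < n.*2.+1 | prime p) (logn p b)%:R * ln p%:R :> R.
  apply: ln_prod_prime => // p pp pb.
  have : (p %| n.*2`!)%N by rewrite -bE dvdn_mulr.
  by rewrite dvdn_fact_prime.
have ub : ln b%:R <= n.*2%:R :> R.
  apply: (@le_trans _ _ (ln (2 ^ n.*2)%:R)); first by rewrite ler_ln_nat.
  rewrite natrX lnXn ?ltr0n// -[leLHS]mulr_natl ler_piMr// ?ler0n//; exact: ln2_le1.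
apply: le_trans ub.
have nn : (n.+1 <= n.*2.+1)%N by rewrite ltnS -addnn leq_addr.
rewrite /theta (big_cat_nat (leq0n n.+1) nn)/= addrAC subrr add0r.
rewrite lb (big_cat_nat (leq0n n.+1) nn)/=.
apply: ler_wpDl.
  by apply: sumr_ge0 => p _; rewrite mulr_ge0 ?ler0n ?ln_nat_ge0.
rewrite big_nat_cond [leRHS]big_nat_cond; apply: ler_sum => p.
move=> /andP[/andP[np pn] pp]; rewrite ler_peMl ?ln_nat_ge0// ler1n logn_gt0.
rewrite mem_primes pp b0/=.
have : (p %| b * (n`! * n`!))%N.
  by rewrite bE dvdn_fact_prime.
rewrite !Euclid_dvdM// !dvdn_fact_prime// => /orP[//|].
by rewrite orbb leqNgt np.
Qed.

(** Doubling sums to a geometric series, so the constant is 2 at powers of two; rounding [n] up to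
    the next power costs another factor 2. *)
Lemma theta_le (R : realType) (n : nat) : theta R n <= 4 * n%:R.
Proof.
have H k : theta R (2 ^ k)%N <= 2 * (2 ^ k)%:R.
  elim: k => [|k IH].
    by rewrite expn0 /theta big_mkcond !big_nat_recr//= big_geq//= !addr0 mulr1.
  have := @theta_double R (2 ^ k)%N; rewrite -muln2 -expnSr.
  by move: IH; rewrite expnS natrM; lra.
case: n => [|n]; first by rewrite /theta big_mkcond big_nat_recr//= big_geq//= addr0 mulr0.
have /andP[l u] := @trunc_log_bounds 2 n.+1 isT isT.
apply: le_trans (theta_mono R (ltnW u)) _.
apply: le_trans (H _) _.
have : (2 ^ trunc_log 2 n.+1)%:R <= n.+1%:R :> R by rewrite ler_nat.
rewrite expnS natrM; lra.
Qed.

(** * Mertens' theorems *)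

Lemma ltr_nat_divn (R : realType) (x d : nat) : (0 < d)%N ->
  x%:R / d%:R < (x %/ d).+1%:R :> R.
Proof.
by move=> d0; rewrite ltr_pdivrMr ?ltr0n// -natrM ltr_nat -ltn_divLR.
Qed.

Lemma ler_divn_nat (R : realType) (x d : nat) : (x %/ d)%:R <= x%:R / d%:R :> R.
Proof.
case: (posnP d) => [->|d0]; first by rewrite divn0 invr0 mulr0.
by rewrite ler_pdivlMr ?ltr0n// -natrM ler_nat leq_divM.
Qed.

(** The linear term is kept exact because, at u = 1/p in Legendre's formula, it produces the main
    term n / p. *)
Lemma sum_geometric_le (R : realType) (u : R) (n : nat) : 0 <= u <= 2^-1 ->
  \sum_(1 <= k < n.+1) u ^+ k <= u + 2 * u ^+ 2.
Proof.
move=> /andP[u0 u2]; elim: n => [|n IH].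
  by rewrite big_geq// addr_ge0// mulr_ge0// sqr_ge0.
rewrite big_nat_recl//=.
under eq_bigr do rewrite exprS.
rewrite -big_distrr/= expr1.
apply: (@le_trans _ _ (u + u * (u + 2 * u ^+ 2))).
  by rewrite lerD2l ler_wpM2l.
nra.
Qed.

Lemma logn_fact_ge (R : realType) (n p : nat) : prime p -> (p <= n)%N ->
  n%:R / p%:R - 1 <= (logn p n`!)%:R :> R.
Proof.
move=> pp pn; have p0 := prime_gt0 pp; have := @ltr_nat_divn R n p p0.
rewrite logn_fact// big_nat_recl ?(leq_trans p0 pn)// expn1 natrD -natr1.
have : 0 <= (\sum_(1 <= i < n) n %/ p ^ i.+1)%:R :> R by rewrite ler0n.
by move: (_ / _) => a; lra.
Qed.

Lemma logn_fact_le (R : realType) (n p : nat) : prime p ->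
  (logn p n`!)%:R <= n%:R / p%:R + 2 * n%:R / p%:R ^+ 2 :> R.
Proof.
move=> pp; have p0 := prime_gt0 pp.
rewrite logn_fact// natr_sum.
have u2 : 0 <= (p%:R^-1 : R) <= 2^-1.
  by rewrite invr_ge0 ler0n/= lef_pV2 ?posrE ?ltr0n// ler_nat prime_gt1.
have := sum_geometric_le n u2 => H.
apply: (@le_trans _ _ (n%:R * \sum_(1 <= k < n.+1) p%:R^-1 ^+ k)).
  rewrite big_distrr/=; apply: ler_sum => k _.
  by apply: le_trans (ler_divn_nat _ _ _) _; rewrite natrX exprVn.
apply: le_trans (ler_wpM2l (ler0n _ _) H) _.
by rewrite exprVn mulrDr mulrA [n%:R * 2]mulrC.
Qed.

Lemma ln_fact_le (R : realType) (n : nat) : ln (n`!)%:R <= n%:R * ln n%:R :> R.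
Proof.
elim: n => [|n IH]; first by rewrite fact0 ln1 mul0r.
rewrite factS natrM lnM ?posrE ?ltr0n ?fact_gt0// -natr1 mulrDl mul1r natr1 addrC lerD2r.
apply: le_trans IH _; rewrite ler_wpM2l//.
by case: n => [|n]; [rewrite ln1 ln0|apply: ler_ln_nat].
Qed.

Lemma ln_fact_ge (R : realType) (n : nat) :
  n%:R * ln n%:R - n%:R <= ln (n`!)%:R :> R.
Proof.
elim: n => [|[|n] IH]; first by rewrite fact0 ln1 mul0r subr0.
  by rewrite -[1`!%N]/1%N ln1 mulr0 sub0r oppr_le0.
rewrite factS natrM lnM ?posrE ?ltr0n ?fact_gt0//.
have := @ln_natS_le R n.+1 isT; move: IH.
rewrite -[n.+2%:R]natr1.
have : 0 < n.+1%:R :> R by [].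
move: (n.+1%:R) (ln _) => x lx x0.
move: (ln (x + 1)) => lx1 IH H.
have : x * (lx1 - lx) <= 1 by rewrite -(@divff _ x) ?gt_eqF// ler_pM2l.
move: H; move: (x^-1) => y; nra.
Qed.

Definition prime_ln_harm (R : realType) (n : nat) : R :=
  \sum_(0 <= p < n.+1 | prime p) ln p%:R / p%:R.

Lemma prime_ln_harmS (R : realType) (n : nat) :
  prime_ln_harm R n.+1 = prime_ln_harm R n + if prime n.+1 then ln n.+1%:R / n.+1%:R else 0.
Proof. by rewrite /prime_ln_harm big_mkcond big_nat_recr//= -big_mkcond. Qed.

(** Legendre's formula for log n! is compared with n log n - n <= log n! <= n log n. Rounding n / p
    down costs at most [theta R n], hence 4n by Chebyshev, on one side. Higher prime powers cost 4n
    on the other, where the n lost in the bound for log n! makes it 5n. *)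
Lemma mertens_first (R : realType) (n : nat) : (0 < n)%N ->
  `|prime_ln_harm R n - ln n%:R| <= 5.
Proof.
move=> n0; have nR : 0 < n%:R :> R by rewrite ltr0n.
have E : ln (n`!)%:R = \sum_(0 <= p < n.+1 | prime p) (logn p n`!)%:R * ln p%:R :> R.
  by apply: ln_prod_prime; [exact: fact_gt0|move=> p pp; rewrite dvdn_fact_prime].
have lo : n%:R * prime_ln_harm R n - theta R n <= ln (n`!)%:R.
  rewrite E /prime_ln_harm /theta big_distrr/= -sumrB [leLHS]big_nat_cond [leRHS]big_nat_cond.
  apply: ler_sum => p /andP[/andP[_ pn] pp].
  have H := ler_wpM2r (@ln_nat_ge0 R p) (@logn_fact_ge R n p pp pn).
  by apply: le_trans H; rewrite mulrBl mul1r mulrA mulrAC.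
have hi : ln (n`!)%:R <= n%:R * prime_ln_harm R n + 4 * n%:R.
  apply: (@le_trans _ _ (n%:R * prime_ln_harm R n +
      2 * n%:R * \sum_(0 <= p < n.+1) ln p%:R / p%:R ^+ 2)); last first.
    have := ler_wpM2l (ltW nR) (@sum_ln_div_sqr_le R n.+1).
    by move: (\sum_(_ <= _ < _) _) => s; lra.
  apply: (@le_trans _ _ (n%:R * prime_ln_harm R n +
      2 * n%:R * \sum_(0 <= p < n.+1 | prime p) ln p%:R / p%:R ^+ 2)).
    rewrite E /prime_ln_harm !big_distrr/= -big_split/=; apply: ler_sum => p pp.
    have H := ler_wpM2r (@ln_nat_ge0 R p) (@logn_fact_le R n p pp).
    apply: le_trans H _; rewrite mulrDl.
    by rewrite [X in X + _]mulrAC mulrA [X in _ + X]mulrAC mulrA.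
  rewrite lerD2l ler_wpM2l// ?mulr_ge0// big_mkcond/=.
  by apply: ler_sum => p _; case: ifP => // _; rewrite divr_ge0 ?ln_nat_ge0// sqr_ge0.
have := @theta_le R n; have := @ln_fact_le R n; have := @ln_fact_ge R n.
move=> f1 f2 th.
have h1 : n%:R * (prime_ln_harm R n - ln n%:R) <= n%:R * 5 by move: lo hi; lra.
have h2 : n%:R * (- 5) <= n%:R * (prime_ln_harm R n - ln n%:R) by move: lo hi; lra.
rewrite ler_pM2l// in h1; rewrite ler_pM2l// in h2.
by rewrite ler_norml h1 h2.
Qed.

Definition prime_harm (R : realType) (n : nat) : R :=
  \sum_(0 <= p < n.+1 | prime p) p%:R^-1.

Lemma prime_harmS (R : realType) (n : nat) :
  prime_harm R n.+1 = prime_harm R n + if prime n.+1 then n.+1%:R^-1 else 0.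
Proof. by rewrite /prime_harm big_mkcond big_nat_recr//= -big_mkcond. Qed.

(** Partial summation of 1/p = (ln p / p) / ln p against the first theorem. The 11 is the 6 from the
    convergence of [F] plus the 5 from putting back [E n / ln n]. *)
Lemma mertens_second (R : realType) :
  exists M : R, forall n, (2 <= n)%N ->
    `|prime_harm R n - ln (ln n%:R) - M| <= 11 / ln n%:R.
Proof.
pose E n : R := prime_ln_harm R n - ln n%:R.
(* The last term of [F] absorbs the boundary term of the partial summation. *)
pose F n : R := prime_harm R n - ln (ln n%:R) - E n / ln n%:R.
have lnV0 n : 0 <= 6 / ln n%:R :> R by rewrite divr_ge0// ln_nat_ge0.
(* With a = ln n and b = ln (n+1), both (b - a)/b and (b - a)/a enclose ln b - ln a, and b - a <= 1,
   so that replacing one by the other costs at most 1/a - 1/b. The term with [E n] costs 5 times as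
   much: together 6. *)
have [|M HM] := @telescope_dominated_cvg R F (fun n => 6 / ln n%:R) 2 lnV0.
  move=> n n2.
  have L0 := @ln_nat_gt0 R n n2; have L1 := @ln_nat_gt0 R n.+1 (leqW n2).
  have n0 : (0 < n)%N by apply: leq_trans n2.
  have LL : ln n%:R <= ln n.+1%:R :> R by apply: ler_ln_nat.
  have Ln : ln n.+1%:R - ln n%:R <= 1 :> R.
    by apply: le_trans (ln_natS_le R n0) _; rewrite invf_le1 ?ltr0n// ler1n.
  have PT : prime_harm R n.+1 - prime_harm R n =
      (prime_ln_harm R n.+1 - prime_ln_harm R n) / ln n.+1%:R.
    rewrite prime_harmS prime_ln_harmS (addrC (prime_harm R n)).
    rewrite (addrC (prime_ln_harm R n)) !addrK; case: ifP => _; last by rewrite mul0r.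
    by rewrite mulrAC divff ?mul1r ?gt_eqF.
  have En := @mertens_first R n n0; rewrite -/(E n) in En.
  have ET : prime_ln_harm R n.+1 - prime_ln_harm R n = ln n.+1%:R - ln n%:R + E n.+1 - E n.
    by rewrite /E; lra.
  have lll := lnB_le L0 L1; have llg := lnB_ge L0 L1.
  have -> : F n.+1 - F n =
      (ln n.+1%:R - ln n%:R) / ln n.+1%:R - (ln (ln n.+1%:R) - ln (ln n%:R))
        + E n * ((ln n%:R)^-1 - (ln n.+1%:R)^-1).
    transitivity (prime_harm R n.+1 - prime_harm R n - (ln (ln n.+1%:R) - ln (ln n%:R))
      - E n.+1 / ln n.+1%:R + E n / ln n%:R).
      by rewrite /F; ring.
    by rewrite PT ET; ring.
  move: LL Ln lll llg L0 L1; set a := ln n%:R; set b := ln n.+1%:R.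
  move: (ln b) (ln a) => lb la ab ba1 h1 h2 a0 b0.
  have V0 : b^-1 <= a^-1 by rewrite lef_pV2.
  have key : (b - a) / a - (b - a) / b <= a^-1 - b^-1.
    rewrite -mulrBr -[leRHS]mul1r ler_wpM2r// subr_ge0//.
  have -> : 6 / a - 6 / b = (a^-1 - b^-1) + 5 * (a^-1 - b^-1) by ring.
  apply: le_trans (ler_normD _ _) _; apply: lerD.
    by rewrite ler_norml; apply/andP; split; lra.
  by rewrite normrM [X in _ * X]ger0_norm ?subr_ge0// ler_wpM2r ?subr_ge0.
exists M => n n2; have L0 := @ln_nat_gt0 R n n2.
have := HM n n2; have := @mertens_first R n (ltnW n2); rewrite -/(E n) => En Fn.
have -> : prime_harm R n - ln (ln n%:R) - M = F n - M + E n / ln n%:R by rewrite /F; ring.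
have -> : 11 / ln n%:R = 6 / ln n%:R + 5 / ln n%:R :> R by rewrite -mulrDl; congr (_ / _); lra.
apply: le_trans (ler_normD _ _) _; apply: lerD => //.
by rewrite normrM [X in _ * X]ger0_norm ?invr_ge0 ?(ltW L0)// ler_wpM2r// invr_ge0 ltW.
Qed.

(** * The Euler product of zeta(1 + d) *)

Lemma harm_euler_gamma (R : realType) (n : nat) : (0 < n)%N ->
  `|harm R n - ln n%:R - euler_gamma R| <= n%:R^-1.
Proof.
have [|n' n0|M HM] :=
  @telescope_dominated_cvg R (fun n => harm R n - ln n%:R) (fun n => n%:R^-1) 1.
- by move=> k; rewrite invr_ge0.
- have := ln_natS_le R n0; have := ln_natS_ge R n0; rewrite harmS => h1 h2.
  by rewrite ler_norml; apply/andP; split; linv.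
suff -> : euler_gamma R = M by exact: HM.
apply: cvg_lim => //.
have E k : series (@harmonic R) k = harm R k.
  by rewrite /series/= /harm big_add1.
have -> : (fun k : nat => series (@harmonic R) k - ln k%:R) = (fun k => harm R k - ln k%:R).
  by apply/funext => k; rewrite E.
apply/cvgrPdist_le => e e0; near=> k.
rewrite distrC; apply: le_trans (HM k _) _; first by near: k; exists 1%N.
rewrite -[e]invrK lef_pV2 ?posrE ?invr_gt0//; last by rewrite ltr0n; near: k; exists 1%N.
by near: k; exact: nbhs_infty_ger.
Unshelve. all: by end_near. Qed.

(** This is n^(-d), with the sign built in; through [expR], its estimates reduce to 1 + t <= e^t. *)
Definition npow (R : realType) (d : R) (n : nat) : R := expR (- (d * ln n%:R)).

Lemma npow_gt0 (R : realType) (d : R) n : 0 < npow d n.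
Proof. exact: expR_gt0. Qed.

Lemma npow1 (R : realType) (d : R) : npow d 1 = 1.
Proof. by rewrite /npow ln1 mulr0 oppr0 expR0. Qed.

Lemma npow_le1 (R : realType) (d : R) n : 0 <= d -> npow d n <= 1.
Proof. by move=> d0; rewrite /npow expR_le1 oppr_le0 mulr_ge0// ln_nat_ge0. Qed.

Lemma npowM (R : realType) (d : R) m n : (0 < m)%N -> (0 < n)%N ->
  npow d (m * n) = npow d m * npow d n.
Proof.
by move=> m0 n0; rewrite /npow natrM lnM ?posrE ?ltr0n// mulrDr opprD expRD.
Qed.

Lemma npowX (R : realType) (d : R) m k : (0 < m)%N -> npow d (m ^ k) = npow d m ^+ k.
Proof.
move=> m0; elim: k => [|k IH]; first by rewrite expn0 npow1 expr0.
by rewrite expnS npowM ?expn_gt0 ?m0// IH exprS.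
Qed.

Lemma npow_anti (R : realType) (d : R) m n : 0 <= d -> (0 < m)%N -> (m <= n)%N ->
  npow d n <= npow d m.
Proof. by move=> d0 m0 mn; rewrite ler_expR lerN2 ler_wpM2l// ler_ln_nat. Qed.

Lemma npow_ge (R : realType) (d : R) n : 1 - d * ln n%:R <= npow d n.
Proof. by have := expR_ge1Dx (- (d * ln n%:R)); rewrite /npow; lra. Qed.

(** This and the next lemma are discrete forms of the derivative -d t^(-d-1) of t^(-d). Telescoping
    them gives 1/d <= zeta(1 + d) <= 1 + 1/d. *)
Lemma npowB_le (R : realType) (d : R) n : 0 <= d -> (0 < n)%N ->
  npow d n - npow d n.+1 <= d * (npow d n / n%:R).
Proof.
move=> d0 n0; have h := ln_natS_le R n0.
have -> : npow d n.+1 = npow d n * expR (- (d * (ln n.+1%:R - ln n%:R))).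
  by rewrite /npow -expRD; congr expR; ring.
rewrite -[X in X - _]mulr1 -mulrBr mulrCA ler_wpM2l ?(ltW (npow_gt0 _ _))//.
have := expR_ge1Dx (- (d * (ln n.+1%:R - ln n%:R))).
have : d * (ln n.+1%:R - ln n%:R) <= d * n%:R^-1 by rewrite ler_wpM2l.
by linv.
Qed.

Lemma npowB_ge (R : realType) (d : R) n : 0 <= d -> (0 < n)%N ->
  d * (npow d n.+1 / n.+1%:R) <= npow d n - npow d n.+1.
Proof.
move=> d0 n0; have h := ln_natS_ge R n0.
have -> : npow d n = npow d n.+1 * expR (d * (ln n.+1%:R - ln n%:R)).
  by rewrite /npow -expRD; congr expR; ring.
rewrite -[X in _ - X]mulr1 -mulrBr mulrCA ler_wpM2l ?(ltW (npow_gt0 _ _))//.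
have := expR_ge1Dx (d * (ln n.+1%:R - ln n%:R)).
have : d * n.+1%:R^-1 <= d * (ln n.+1%:R - ln n%:R) by rewrite ler_wpM2l.
by linv.
Qed.

Lemma cvgn_npow0 (R : realType) (d : R) : 0 < d -> npow d @ \oo --> 0.
Proof.
move=> d0; apply/cvgrPdist_le => e e0; near=> n.
rewrite sub0r normrN gtr0_norm ?npow_gt0//.
rewrite -[leRHS]lnK ?posrE// ler_expR lerNl -ler_pdivrMl//.
have h : expR (d^-1 * - ln e) <= n%:R by near: n; exact: nbhs_infty_ger.
rewrite -[leLHS]expRK ler_ln ?posrE ?expR_gt0//.
by apply: lt_le_trans h; exact: expR_gt0.
Unshelve. all: by end_near. Qed.

Definition zetaN (R : realType) (d : R) (N : nat) : R :=
  \sum_(1 <= n < N.+1) npow d n / n%:R.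

Lemma zetaN_le (R : realType) (d : R) (N : nat) : 0 < d -> zetaN d N <= 1 + d^-1.
Proof.
move=> d0; suff H : zetaN d N.+1 <= 1 + d^-1 * (1 - npow d N.+1).
  have h1 : zetaN d N <= zetaN d N.+1.
    by rewrite /zetaN [leRHS]big_nat_recr//= lerDl divr_ge0// ltW// npow_gt0.
  apply: le_trans h1 _; apply: le_trans H _; rewrite lerD2l.
  by apply: ler_piMr; [rewrite invr_ge0 ltW|rewrite gerBl ltW// npow_gt0].
elim: N => [|N IH].
  by rewrite /zetaN big_nat1 npow1 subrr mulr0 addr0 divr1.
rewrite /zetaN big_nat_recr//= -/(zetaN d N.+1).
have := @npowB_ge R d N.+1 (ltW d0) isT; rewrite -ler_pdivlMl// => H.
by move: IH H; rewrite !mulrBr; linv.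
Qed.

Lemma zetaN_ge (R : realType) (d : R) (N : nat) : 0 < d ->
  d^-1 * (1 - npow d N.+1) <= zetaN d N.
Proof.
move=> d0; elim: N => [|N IH].
  by rewrite npow1 subrr mulr0 /zetaN big_geq.
rewrite /zetaN big_nat_recr//= -/(zetaN d N).
have := @npowB_le R d N.+1 (ltW d0) isT; rewrite -ler_pdivrMl// => H.
by move: IH H; rewrite !mulrBr; linv.
Qed.

(* [zeta1 d] is zeta(1 + d). *)
Definition zeta1 (R : realType) (d : R) : R := limn (zetaN d).

Lemma zetaN_homo (R : realType) (d : R) : {homo zetaN d : m n / (m <= n)%N >-> m <= n}.
Proof.
move=> m n mn; rewrite /zetaN [leRHS](@big_cat_nat _ _ _ m.+1)//= lerDl.
by apply: sumr_ge0 => k _; rewrite divr_ge0// ltW// npow_gt0.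
Qed.

Lemma zeta1_cvg (R : realType) (d : R) : 0 < d -> zetaN d @ \oo --> zeta1 d.
Proof.
move=> d0; apply: nondecreasing_is_cvgn; first exact: zetaN_homo.
by exists (1 + d^-1) => _ [n _ <-]; exact: zetaN_le.
Qed.

Lemma zeta1_le (R : realType) (d : R) : 0 < d -> zeta1 d <= 1 + d^-1.
Proof.
move=> d0; apply: limr_le; first exact: zeta1_cvg.
by apply: nearW => n; exact: zetaN_le.
Qed.

Lemma zeta1_ge (R : realType) (d : R) : 0 < d -> d^-1 <= zeta1 d.
Proof.
move=> d0.
have h : (fun N => d^-1 * (1 - npow d N.+1)) @ \oo --> d^-1 * (1 - 0).
  apply: cvgM; first exact: cvg_cst.
  apply: cvgB; first exact: cvg_cst.
  by have := cvgn_npow0 d0; rewrite -(cvg_shiftS (npow d)).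
rewrite subr0 mulr1 in h.
apply: ler_cvg_to h (zeta1_cvg d0) _.
by apply: nearW => N; exact: zetaN_ge.
Qed.

Lemma ln_zeta1 (R : realType) (d : R) : 0 < d -> `|ln (zeta1 d) + ln d| <= d.
Proof.
move=> d0; have z0 : 0 < zeta1 d by apply: lt_le_trans (zeta1_ge d0); rewrite invr_gt0.
rewrite -lnM ?posrE//.
have h1 : 1 <= zeta1 d * d by rewrite -(@mulVf _ d) ?gt_eqF// ler_pM2r// zeta1_ge.
have h2 : zeta1 d * d <= 1 + d.
  have : zeta1 d * d <= (1 + d^-1) * d by rewrite ler_pM2r// zeta1_le.
  by rewrite mulrDl mul1r mulVf ?gt_eqF// addrC.
rewrite ger0_norm ?ln_ge0//.
by apply: le_trans (ln_le_sub1 _) _; [lra|lra].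
Qed.

Lemma sum_multiples (V : nmodType) (q N : nat) (F : nat -> V) : (0 < q)%N ->
  \sum_(1 <= n < N.+1 | (q %| n)%N) F n = \sum_(1 <= m < (N %/ q)%N.+1) F (q * m)%N.
Proof.
move=> q0; elim: N => [|N IH]; first by rewrite div0n !big_geq.
rewrite big_mkcond big_nat_recr//= -big_mkcond IH divnS//.
case: ifP => qN; last by rewrite addr0.
rewrite add1n [RHS]big_nat_recr//=; congr (_ + F _).
by have := divnS N q0; rewrite qN add1n => <-; rewrite mulnC divnK.
Qed.

(** Holds when no prime up to [y] divides [n]. As a test over an initial segment, it gains exactly
    one conjunct when [y] grows by one. *)
Definition rough (y n : nat) : bool :=
  all (fun p => prime p ==> ~~ (p %| n)%N) (iota 0 y.+1).

Lemma roughS y n : rough y.+1 n = rough y n && (prime y.+1 ==> ~~ (y.+1 %| n)%N).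
Proof. by rewrite /rough -[y.+2]addn1 iotaD all_cat /= andbT. Qed.

Lemma rough0 n : rough 0 n.
Proof. by []. Qed.

Lemma rough1 y : rough y 1.
Proof.
by apply/allP => p _; apply/implyP => pp; rewrite dvdn1; case: p pp => [|[]].
Qed.

Lemma rough_gt y n : (1 < n)%N -> rough y n -> (y < n)%N.
Proof.
move=> n1 /allP H; rewrite ltnNge; apply/negP => ny.
have := H (pdiv n); rewrite mem_iota/= add0n ltnS (leq_trans (pdiv_leq (ltnW n1)) ny).
by move=> /(_ isT); rewrite pdiv_prime// pdiv_dvd.
Qed.

Lemma rough_mul y m : prime y.+1 -> rough y (y.+1 * m) = rough y m.
Proof.
move=> qp; apply: eq_in_all => p; rewrite mem_iota add0n => /andP[_ py].
case: (boolP (prime p)) => //= pp; rewrite Euclid_dvdM// dvdn_prime2//.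
by rewrite ltn_eqF.
Qed.

Definition zetaR (R : realType) (d : R) (y N : nat) : R :=
  \sum_(1 <= n < N.+1 | rough y n) npow d n / n%:R.

Definition eulerP (R : realType) (d : R) (y : nat) : R :=
  \prod_(0 <= p < y.+1 | prime p) (1 - npow d p / p%:R).

Lemma eulerPS (R : realType) (d : R) (y : nat) :
  eulerP d y.+1 = eulerP d y * if prime y.+1 then 1 - npow d y.+1 / y.+1%:R else 1.
Proof. by rewrite /eulerP big_mkcond big_nat_recr//= -big_mkcond. Qed.

(** One step of the sieve with q = y + 1: the multiples of q to be removed are the q m with m again
    [y]-rough and m <= N / q. As N tends to infinity so does N / q, and the step becomes
    multiplication by 1 - q^(-1-d). *)
Lemma zetaRS (R : realType) (d : R) (y N : nat) : prime y.+1 ->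
  zetaR d y.+1 N = zetaR d y N - npow d y.+1 / y.+1%:R * zetaR d y (N %/ y.+1).
Proof.
move=> qp; apply/eqP; rewrite eq_sym subr_eq; apply/eqP.
rewrite /zetaR (bigID (fun n => (y.+1 %| n)%N))/= addrC; congr (_ + _).
  by apply: eq_bigl => n; rewrite roughS qp.
under eq_bigl do rewrite andbC.
rewrite big_mkcondr/=.
rewrite (sum_multiples N (fun n => if rough y n then npow d n / n%:R else 0) (ltn0Sn y)).
rewrite big_distrr/= [RHS]big_mkcond/= big_nat [RHS]big_nat; apply: eq_bigr => m /andP[m0 _].
rewrite rough_mul//; case: ifP => // _.
by rewrite npowM// natrM invfM; ring.
Qed.

Lemma zetaR_cvg (R : realType) (d : R) (y : nat) : 0 < d ->
  zetaR d y @ \oo --> zeta1 d * eulerP d y.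
Proof.
move=> d0; elim: y => [|y IH].
  rewrite /eulerP big_mkcond big_nat1/= mulr1.
  have -> : zetaR d 0 = zetaN d by apply/funext => N; apply: eq_bigl => n; rewrite rough0.
  exact: zeta1_cvg.
rewrite eulerPS; case: (boolP (prime y.+1)) => qp; last first.
  rewrite mulr1; have -> : zetaR d y.+1 = zetaR d y.
    by apply/funext => N; apply: eq_bigl => n; rewrite roughS (negbTE qp) andbT.
  exact: IH.
have -> : zetaR d y.+1 =
    (fun N => zetaR d y N - npow d y.+1 / y.+1%:R * zetaR d y (N %/ y.+1)).
  by apply/funext => N; exact: zetaRS.
rewrite mulrA mulrBr mulr1 [X in _ - X]mulrC.
apply: cvgB => //; apply: cvgM; first exact: cvg_cst.
apply: (@cvg_comp _ _ _ (fun N => N %/ y.+1)%N (zetaR d y)) IH.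
apply/cvgnyPge => A; near=> N; rewrite leq_divRL//.
by near: N; exists (A * y.+1)%N.
Unshelve. all: by end_near. Qed.

Lemma zetaR_ge1 (R : realType) (d : R) (y N : nat) : (0 < N)%N -> 1 <= zetaR d y N.
Proof.
case: N => // N _; rewrite /zetaR big_mkcond big_nat_recl//= rough1 npow1 divr1 lerDl.
by apply: sumr_ge0 => n _; case: ifP => // _; rewrite divr_ge0// ltW// npow_gt0.
Qed.

Lemma zetaR_le (R : realType) (d : R) (y N : nat) : (0 < y)%N -> (y <= N)%N ->
  zetaR d y N <= 1 + (zetaN d N - zetaN d y).
Proof.
move=> y0 yN; rewrite /zetaR /zetaN big_mkcond.
rewrite !(@big_cat_nat _ _ _ y.+1 1 N.+1)//= [X in _ <= _ + (X - _)]addrC addrK.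
apply: lerD; last first.
  by apply: ler_sum => n _; case: ifP => // _; rewrite divr_ge0// ltW// npow_gt0.
rewrite big_nat_recl//= rough1 npow1 divr1 big_nat big1 ?addr0// => n /andP[n0 ny].
case: ifP => // /rough_gt -/(_ n0); rewrite ltnNge (leq_trans ny)//.
Qed.

(** The middle term is the sum of n^(-1-d) over [y]-rough n. It contains n = 1, and all its other n
    exceed [y], so they are covered by the tail of the zeta series. *)
Lemma euler_product_bounds (R : realType) (d : R) (y : nat) : 0 < d -> (0 < y)%N ->
  1 <= zeta1 d * eulerP d y <= 1 + (zeta1 d - zetaN d y).
Proof.
move=> d0 y0; apply/andP; split.
  have h : (fun _ : nat => 1 : R) @ \oo --> (1 : R) by exact: cvg_cst.
  apply: ler_cvg_to h (@zetaR_cvg R d y d0) _.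
  by near=> N; apply: zetaR_ge1; near: N; exists 1%N.
have h : (fun N => 1 + (zetaN d N - zetaN d y)) @ \oo --> 1 + (zeta1 d - zetaN d y).
  apply: cvgD; first exact: cvg_cst.
  by apply: cvgB; [exact: zeta1_cvg|exact: cvg_cst].
apply: ler_cvg_to (@zetaR_cvg R d y d0) h _.
by near=> N; apply: zetaR_le => //; near: N; exists y.
Unshelve. all: by end_near. Qed.

Lemma natr_prime_ge2 (R : realType) (p : nat) : prime p -> 2 <= p%:R :> R.
Proof. by move=> /prime_gt1; rewrite ler_nat. Qed.

Lemma prime_invr_bounds (R : realType) (p : nat) : prime p -> 0 <= (p%:R^-1 : R) <= 2^-1.
Proof.
move=> pp; rewrite invr_ge0 ler0n/= lef_pV2 ?posrE ?ltr0n ?prime_gt0//.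
exact: natr_prime_ge2.
Qed.

Lemma npow_prime_bounds (R : realType) (d : R) (p : nat) : 0 <= d -> prime p ->
  0 <= npow d p / p%:R <= p%:R^-1.
Proof.
move=> d0 pp; rewrite divr_ge0 ?ler0n ?(ltW (npow_gt0 _ _))//=.
by rewrite ler_piMl ?invr_ge0// npow_le1.
Qed.

Definition lnEuler (R : realType) (d : R) (N : nat) : R :=
  \sum_(0 <= p < N.+1 | prime p) ln (1 - npow d p / p%:R).

Lemma ln_eulerP (R : realType) (d : R) (N : nat) : 0 <= d ->
  0 < eulerP d N /\ ln (eulerP d N) = lnEuler d N.
Proof.
move=> d0; rewrite /eulerP /lnEuler.
elim: (index_iota _ _) => [|p s [IH0 IH]]; first by rewrite !big_nil ln1.
rewrite !big_cons; case: ifP => // pp.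
have f0 : 0 < 1 - npow d p / p%:R.
  have /andP[_ h1] := npow_prime_bounds d0 pp.
  by have /andP[_ h2] := @prime_invr_bounds R p pp; lra.
by split; [exact: mulr_gt0|rewrite lnM ?posrE// IH].
Qed.

Lemma lnEuler_cvg (R : realType) (d : R) : 0 < d ->
  lnEuler d @ \oo --> - ln (zeta1 d).
Proof.
move=> d0; have z0 : 0 < zeta1 d by apply: lt_le_trans (zeta1_ge d0); rewrite invr_gt0.
have h : (fun N => ln (1 + (zeta1 d - zetaN d N)) - ln (zeta1 d)) @ \oo -->
    ln 1 - ln (zeta1 d).
  apply: cvgB; last exact: cvg_cst.
  have c1 : (fun N => 1 + (zeta1 d - zetaN d N)) @ \oo --> 1 + (zeta1 d - zeta1 d).
    apply: cvgD; first exact: cvg_cst.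
    by apply: cvgB; [exact: cvg_cst|exact: zeta1_cvg].
  rewrite subrr addr0 in c1.
  exact: (@cvg_comp _ _ _ _ (@ln R) _ _ _ c1 (continuous_ln ltr01)).
rewrite ln1 sub0r in h.
apply: squeeze_cvgr (cvg_cst _) h; near=> N.
have N0 : (0 < N)%N by near: N; exists 1%N.
have [e0 <-] := @ln_eulerP R d N (ltW d0).
have /andP[h1 h2] := euler_product_bounds d0 N0.
have ze : 0 < zeta1 d * eulerP d N by rewrite mulr_gt0.
have zE : ln (zeta1 d * eulerP d N) = ln (zeta1 d) + ln (eulerP d N) by rewrite lnM ?posrE.
have l1 : 0 <= ln (zeta1 d * eulerP d N) by rewrite ln_ge0.
have l2 : ln (zeta1 d * eulerP d N) <= ln (1 + (zeta1 d - zetaN d N)).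
  by rewrite ler_ln ?posrE//; apply: lt_le_trans h2.
by apply/andP; split; lra.
Unshelve. all: by end_near. Qed.

(** * The series of log(1 - 1/p) + 1/p and its perturbation in d *)

Definition lncorr (R : realType) (u : R) : R := ln (1 - u) + u.

(** The derivative of [lncorr] is -u/(1 - u), of size at most 2v on [0, v] for v <= 1/2. The case u
    = 0 gives convergence over primes; u = p^(-1-d) and v = 1/p give the passage to d = 0. *)
Lemma lncorrB (R : realType) (u v : R) : 0 <= u -> u <= v -> v <= 2^-1 ->
  0 <= lncorr u - lncorr v <= 2 * v * (v - u).
Proof.
move=> u0 uv v2; rewrite /lncorr.
have v1 : 0 < 1 - v by lra.
have u1 : 0 < 1 - u by lra.
have := lnB_le v1 u1; have := lnB_ge v1 u1.
move: (ln _) (ln _) => a b h1 h2.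
have w0 : 0 <= v - u by rewrite subr_ge0.
have w1 := mulr_ge0 u0 w0; have w2 := mulr_ge0 (le_trans u0 uv) w0.
have w3 : 0 <= v * (v - u) * (1 - 2 * v) by rewrite mulr_ge0//; lra.
have h3 : v - u <= (1 - u - (1 - v)) / (1 - u) by rewrite ler_pdivlMr//; lra.
have h4 : (1 - u - (1 - v)) / (1 - v) <= (v - u) * (1 + 2 * v) by rewrite ler_pdivrMr//; lra.
by apply/andP; split; lra.
Qed.

Definition lncorr_sum (R : realType) (N : nat) : R :=
  \sum_(0 <= p < N.+1 | prime p) lncorr p%:R^-1.

Lemma invr_sqrS_le (R : realType) (n : nat) : (0 < n)%N ->
  n.+1%:R ^- 2 <= n%:R^-1 - n.+1%:R^-1 :> R.
Proof.
move=> n0; have : 0 < n%:R :> R by rewrite ltr0n.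
rewrite -natr1; move: (n%:R) => x x0.
have -> : x^-1 - (x + 1)^-1 = (x * (x + 1))^-1 by field; rewrite !gt_eqF; lra.
by rewrite lef_pV2 ?posrE ?exprn_gt0 ?mulr_gt0; nra.
Qed.

Lemma lncorr_sum_cvg (R : realType) : exists C : R, lncorr_sum R @ \oo --> C.
Proof.
have [||C HC] := @telescope_dominated_cvg R (lncorr_sum R) (fun n => 2 * n%:R^-1) 1.
- by move=> n; rewrite mulr_ge0 ?invr_ge0.
- move=> n n0; rewrite -mulrBr.
  have -> : lncorr_sum R n.+1 - lncorr_sum R n = if prime n.+1 then lncorr n.+1%:R^-1 else 0.
    by rewrite /lncorr_sum big_mkcond big_nat_recr//= -big_mkcond addrC addrK.
  apply: (@le_trans _ _ (2 * n.+1%:R ^- 2)); last by rewrite ler_pM2l// invr_sqrS_le.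
  case: ifP => pp; last by rewrite normr0 mulr_ge0// invr_ge0 sqr_ge0.
  have /andP[p0 p2] := @prime_invr_bounds R _ pp.
  have /andP[] := lncorrB (lexx 0) p0 p2.
  have -> : lncorr (0 : R) = 0 by rewrite /lncorr subr0 ln1 addr0.
  rewrite sub0r subr0 oppr_ge0 -mulrA -expr2 exprVn => h1 h2.
  by rewrite ler0_norm.
exists C; apply/cvgrPdist_le => e e0; near=> k.
rewrite distrC; apply: le_trans (HC k _) _; first by near: k; exists 1%N.
have k0 : 0 < k%:R :> R by rewrite ltr0n; near: k; exists 1%N.
rewrite ler_pdivrMr// mulrC -ler_pdivrMr//.
by near: k; exact: nbhs_infty_ger.
Unshelve. all: by end_near. Qed.

(** The first two sums combine to [lncorr] at p^(-1-d). Moving each argument to 1/p costs at most 2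
    (1 - p^(-d)) / p^2 <= 2 d log p / p^2, whose sum is at most 4d for every [N]. *)
Lemma sum_npow_prime (R : realType) (d : R) (N : nat) : 0 <= d ->
  `|\sum_(0 <= p < N.+1 | prime p) npow d p / p%:R + lnEuler d N - lncorr_sum R N|
  <= 4 * d.
Proof.
move=> d0; rewrite /lnEuler /lncorr_sum -big_split/= -sumrB.
apply: le_trans (ler_norm_sum _ _ _) _.
apply: (@le_trans _ _ (2 * d * \sum_(0 <= p < N.+1) ln p%:R / p%:R ^+ 2)).
  rewrite big_distrr/= big_mkcond/=; apply: ler_sum => p _.
  case: ifP => pp; last by rewrite !mulr_ge0 ?ln_nat_ge0 ?invr_ge0 ?sqr_ge0.
  have /andP[u0 uv] := npow_prime_bounds d0 pp.
  have /andP[v0 v2] := @prime_invr_bounds R p pp.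
  have /andP[h1 h2] := lncorrB u0 uv v2.
  rewrite addrC -/(lncorr _) ger0_norm//; apply: le_trans h2 _.
  have -> : p%:R^-1 - npow d p / p%:R = p%:R^-1 * (1 - npow d p) by ring.
  have -> : 2 * p%:R^-1 * (p%:R^-1 * (1 - npow d p)) = 2 * p%:R ^- 2 * (1 - npow d p).
    by rewrite -exprVn; ring.
  have -> : 2 * d * (ln p%:R / p%:R ^+ 2) = 2 * p%:R ^- 2 * (d * ln p%:R) by ring.
  rewrite ler_wpM2l ?mulr_ge0 ?invr_ge0 ?sqr_ge0//.
  by have := @npow_ge R d p; lra.
have := ler_wpM2l d0 (@sum_ln_div_sqr_le R N.+1).
by move: (\sum_(_ <= _ < _) _) => s; lra.
Qed.

(** * The power series of -log(1 - r) *)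

Definition logser (R : realType) (r : R) (K : nat) : R :=
  \sum_(1 <= k < K.+1) r ^+ k / k%:R.

Lemma is_derive_logser (R : realType) (K : nat) (t : R) :
  is_derive t 1 (fun t : R => logser t K) (\sum_(i < K) t ^+ i).
Proof.
elim: K => [|K IH].
  rewrite big_ord0; have -> : (fun t : R => logser t 0) = cst 0.
    by apply/funext => s; rewrite /logser big_geq.
  exact: is_derive_cst.
have -> : (fun t : R => logser t K.+1) =
    (fun t : R => logser t K) + K.+1%:R^-1 \*: ((@id R) ^+ K.+1).
  apply/funext => s; rewrite /logser big_nat_recr//= mulrC.
  rewrite fctE; congr (_ + _); rewrite /GRing.scale/=; congr (_ * _).
  by rewrite exprfctE.
rewrite big_ord_recr/=; apply: is_deriveD.
have h := @is_deriveZ R R R _ K.+1%:R^-1 _ _ _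
  (@is_deriveX R R (@id R) K.+1 t 1 _ (is_derive_id t 1)).
apply: is_derive_eq h _.
by rewrite /GRing.scale/= mulr1 mulrA mulVf ?mul1r// pnatr_eq0.
Qed.

(** Mean value theorem for the remainder, whose derivative collapses to t^K / (1 - t) by the finite
    geometric sum. *)
Lemma logser_bounds (R : realType) (r : R) (K : nat) : 0 < r -> r < 1 ->
  0 <= - ln (1 - r) - logser r K <= r ^+ K / (1 - r).
Proof.
move=> r0 r1.
pose f (t : R) := - ln (1 - t) - logser t K.
pose df (t : R) := (1 - t)^-1 - \sum_(i < K) t ^+ i.
have fd (t : R) : t < 1 -> is_derive t 1 f (df t).
  move=> t1; have t10 : 0 < 1 - t by lra.
  apply: is_deriveB; last exact: is_derive_logser.
  have h1 : is_derive t 1 (fun t : R => 1 - t) (0 - 1).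
    by apply: is_deriveB.
  have h2 := @is_derive1_comp R (@ln R) (fun t : R => 1 - t) t _ _ (is_derive1_ln t10) h1.
  have h3 := is_deriveN h2.
  by apply: is_derive_eq h3 _; ring.
have [||c] := @MVT R f df 0 r r0.
- by move=> t; rewrite in_itv/= => /andP[_ tr]; apply: fd; apply: lt_trans r1.
- apply: derivable_within_continuous => t; rewrite in_itv/= => /andP[_ tr].
  by have [] := fd t (le_lt_trans tr r1).
rewrite in_itv/= => /andP[c0 cr].
have -> : f 0 = 0.
  rewrite /f subr0 ln1 /logser oppr0 sub0r big_nat big1 ?oppr0// => k /andP[k0 _].
  by rewrite expr0n gtn_eqF// mul0r.
rewrite !subr0 -/(f r) => ->.
have c1 : c < 1 by apply: lt_trans r1.
have c10 : 0 < 1 - c by lra.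
have -> : df c = c ^+ K / (1 - c).
  rewrite /df; have := subrX1 c K => h.
  apply: (@mulIf _ (1 - c)); first by rewrite gt_eqF.
  rewrite mulrBl mulVf ?gt_eqF// divfK ?gt_eqF//.
  by move: h; lra.
have h0 : 0 <= c ^+ K / (1 - c) by rewrite divr_ge0// ?exprn_ge0// ltW.
rewrite (mulr_ge0 h0 (ltW r0))/=.
apply: (@le_trans _ _ (c ^+ K / (1 - c))); first by rewrite ler_piMr// ltW.
apply: ler_pM; [by rewrite exprn_ge0// ltW|by rewrite invr_ge0 ltW| |].
  by rewrite lerXn2r ?nnegrE ?(ltW c0) ?(ltW r0) ?(ltW cr).
by rewrite lef_pV2 ?posrE; lra.
Qed.

Lemma logser_cvg (R : realType) (r : R) : 0 < r -> r < 1 ->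
  logser r @ \oo --> - ln (1 - r).
Proof.
move=> r0 r1.
have h : (fun K => - ln (1 - r) - r ^+ K / (1 - r)) @ \oo --> - ln (1 - r) - 0 / (1 - r).
  apply: cvgB; first exact: cvg_cst.
  apply: cvgM; last exact: cvg_cst.
  by apply: cvg_expr; rewrite gtr0_norm.
rewrite mul0r subr0 in h.
apply: squeeze_cvgr h (cvg_cst _); apply: nearW => K.
by have /andP[h1 h2] := logser_bounds K r0 r1; apply/andP; split; lra.
Qed.

(** Follows from a / (1 + a) <= 1 - e^(-a) <= a. At a = d log 2 it is the source of the log log
    2. *)
Lemma ln_1subexpR (R : realType) (a : R) : 0 < a ->
  `|ln (1 - expR (- a)) - ln a| <= a.
Proof.
move=> a0; have e1 := expR_ge1Dx (- a); have e2 := expR_ge1Dx a.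
have e3 : expR (- a) < 1 by rewrite expR_lt1; lra.
have h1 : ln (1 - expR (- a)) <= ln a by rewrite ler_ln ?posrE//; lra.
have a1 : 0 < 1 + a by lra.
have h2 : a / (1 + a) <= 1 - expR (- a).
  have : expR (- a) <= (1 + a)^-1 by rewrite expRN lef_pV2 ?posrE ?expR_gt0.
  have -> : a / (1 + a) = 1 - (1 + a)^-1 by field; rewrite gt_eqF.
  by lra.
have h3 : ln a - ln (1 + a) <= ln (1 - expR (- a)).
  by rewrite -ln_div ?posrE// ler_ln ?posrE ?divr_gt0//; lra.
have h4 := ln_le_sub1 a1.
by rewrite ler_norml; apply/andP; split; lra.
Qed.

(** * The constant in the second Mertens theorem *)

(** The step function n -> H(floor(log_2 n)) jumps only at powers 2^k, and there by 1/k. So it plays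
    for sum_k g(2^k) / k the role that [prime_harm] plays for the sum over primes. *)
Lemma sum_trunc_log_harm (R : realType) (g : nat -> R) (N : nat) : (0 < N)%N ->
  \sum_(1 <= n < N) (harm R (trunc_log 2 n.+1) - harm R (trunc_log 2 n)) * g n.+1
  = \sum_(1 <= k < (trunc_log 2 N).+1) g (2 ^ k)%N / k%:R.
Proof.
elim: N => // -[|N] IH _; first by rewrite (trunc_expnK 0) ?big_geq.
rewrite big_nat_recr//= IH//; set k := trunc_log 2 N.+1.
have /andP[l u] := @trunc_log_bounds 2 N.+1 isT isT; rewrite -/k in l u.
case: (ltnP N.+2 (2 ^ k.+1)) => h.
  rewrite (@trunc_log_eq 2 k N.+2)//; last by rewrite h (leq_trans l).
  by rewrite subrr mul0r addr0.
have E : N.+2 = (2 ^ k.+1)%N by apply/eqP; rewrite eqn_leq h andbT.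
rewrite E trunc_expnK// [RHS]big_nat_recr//=; congr (_ + _).
by rewrite harmS addrC addKr mulrC.
Qed.

Lemma sum_prime_harm_diff (R : realType) (d : R) (N : nat) : (0 < N)%N ->
  \sum_(1 <= n < N) (prime_harm R n.+1 - prime_harm R n) * npow d n.+1
  = \sum_(0 <= p < N.+1 | prime p) npow d p / p%:R.
Proof.
elim: N => // -[|N] IH _.
  by rewrite big_geq// big_mkcond !big_nat_recr//= big_geq//= !addr0.
rewrite big_nat_recr//= IH// [RHS]big_mkcond [RHS]big_nat_recr//= -big_mkcond.
congr (_ + _); rewrite prime_harmS addrC addKr.
by case: ifP => _; [rewrite mulrC|rewrite mul0r].
Qed.

Lemma abel_sum (R : realType) (B w : nat -> R) (N : nat) : (0 < N)%N ->
  \sum_(1 <= n < N) (B n.+1 - B n) * w n.+1 =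
  B N * w N - B 1%N * w 1%N + \sum_(1 <= n < N) B n * (w n - w n.+1).
Proof.
elim: N => // -[|N] IH _; first by rewrite !big_geq//; ring.
by rewrite !(big_nat_recr N.+1)//= IH//; ring.
Qed.

Lemma cvgn_norm_le (R : realType) (u : nat -> R) (l c : R) (n0 : nat) :
  u @ \oo --> l -> (forall n, (n0 <= n)%N -> `|u n| <= c) -> `|l| <= c.
Proof.
move=> ul uc.
have h : (fun _ : nat => c) @ \oo --> c by exact: cvg_cst.
apply: ler_cvg_to (cvg_norm ul) h _.
by near=> n; apply: uc; near: n; exists n0.
Unshelve. all: by end_near. Qed.

Lemma ln2_ge (R : realType) : 2^-1 <= ln 2 :> R.
Proof. by have := @ln_ge_1subV R 2 ltac:(lra); lra. Qed.

Lemma trunc_log_lnln (R : realType) (n : nat) : (2 <= n)%N ->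
  let k := trunc_log 2 n in
  [/\ (0 < k)%N, k%:R * ln 2 <= ln n%:R :> R
    & 0 <= (ln (ln n%:R) - ln (ln 2) - ln k%:R : R) <= k%:R^-1].
Proof.
move=> n2 k.
have /andP[l u] := @trunc_log_bounds 2 n isT (ltnW n2); rewrite -/k in l u.
have k0 : (0 < k)%N by rewrite lt0n; apply/eqP => kE; rewrite kE expn1 ltnNge n2 in u.
have L2 := @ln2_ge R; have L20 : 0 < ln 2 :> R by lra.
have kR : 0 < k%:R :> R by rewrite ltr0n.
have h1 : k%:R * ln 2 <= ln n%:R :> R.
  by rewrite mulr_natl -lnXn// -natrX ler_ln_nat// expn_gt0.
have h2 : ln n%:R <= k.+1%:R * ln 2 :> R.
  by rewrite mulr_natl -lnXn// -natrX ler_ln_nat// ltnW.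
have n0 : 0 < ln n%:R :> R by apply: ln_nat_gt0.
split=> //.
have e1 : ln k%:R + ln (ln 2) <= ln (ln n%:R) :> R.
  by rewrite -lnM ?posrE// ler_ln ?posrE ?mulr_gt0.
have e2 : ln (ln n%:R) <= ln k.+1%:R + ln (ln 2) :> R.
  by rewrite -lnM ?posrE// ler_ln ?posrE ?mulr_gt0.
have e3 := @ln_natS_le R k k0.
by apply/andP; split; linv.
Qed.

(** With k = floor(log_2 n), both sums are log k plus a constant, since log log n = log k + log log
    2 + O(1/k). The 24 is 22 + 1 + 1, where 11 / ln n <= 22 / k because ln n >= k ln 2 >= k / 2. *)
Lemma prime_harm_close (R : realType) (M : R) (n : nat) :
  (forall n, (2 <= n)%N -> `|prime_harm R n - ln (ln n%:R) - M| <= 11 / ln n%:R) ->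
  (2 <= n)%N ->
  `|prime_harm R n - harm R (trunc_log 2 n) - (M + ln (ln 2) - euler_gamma R)|
  <= 24 / (trunc_log 2 n)%:R.
Proof.
move=> HM n2; have [k0 kl /andP[l1 l2]] := @trunc_log_lnln R n n2.
have h1 := HM n n2; have h2 := @harm_euler_gamma R _ k0.
move: k0 kl l1 l2 h2; set k := trunc_log 2 n => k0 kl l1 l2 h2.
have kR : 0 < k%:R :> R by rewrite ltr0n.
have L2 := @ln2_ge R.
have h3 : 11 / ln n%:R <= 22 / k%:R :> R.
  rewrite ler_pdivrMr; last by apply: ln_nat_gt0.
  rewrite mulrAC ler_pdivlMr//; nra.
have -> : prime_harm R n - harm R k - (M + ln (ln 2) - euler_gamma R) =
  (prime_harm R n - ln (ln n%:R) - M) - (harm R k - ln k%:R - euler_gamma R)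
  + (ln (ln n%:R) - ln (ln 2) - ln k%:R) by ring.
have -> : 24 / k%:R = 22 / k%:R + k%:R^-1 + k%:R^-1 :> R by ring.
apply: le_trans (ler_normD _ _) _; apply: lerD; last by rewrite ger0_norm.
apply: le_trans (ler_normB _ _) _; apply: lerD => //.
exact: le_trans h3.
Qed.

(* Both sum_p p^(-1-d) = log(1/d) + C + O(d) and sum_k 2^(-kd)/k
   = log(1/d) - log log 2 + O(d) as d -> 0, while by Abel summation their
   difference tends to the limit of the difference of the partial sums, taken
   over p <= n and 2^k <= n. *)
Lemma mertens_constant (R : realType) (M C : R) :
  (forall n, (2 <= n)%N -> `|prime_harm R n - ln (ln n%:R) - M| <= 11 / ln n%:R) ->
  lncorr_sum R @ \oo --> C -> M = euler_gamma R + C.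
Proof.
move=> HM HC.
(* The 9 is 3e + 4d from the bound on [X], plus d for log zeta(1 + d) and d for log(1 - 2^(-d)),
   with d <= e. *)
suff H : forall e : R, 0 < e -> `|euler_gamma R + C - M| <= 9 * e.
  apply/esym/eqP; rewrite -subr_eq0 -normr_le0; apply/ler_addgt0Pl => e e0.
  have e9 : 0 < e / 9 by rewrite divr_gt0.
  by apply: le_trans (H _ e9) _; rewrite addr0 mulrC divfK// pnatr_eq0.
move=> e e0; pose L := M + ln (ln 2) - euler_gamma R.
pose B n := prime_harm R n - harm R (trunc_log 2 n) - L.
have B1 : B 1%N = - L.
  rewrite /B (trunc_expnK 0)// harm0 /prime_harm big_mkcond !big_nat_recr//= big_geq//=.
  by ring.
pose j := (Num.truncn (24 / e)).+1.
have je : 24 / j%:R <= e.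
  rewrite ler_pdivrMr ?ltr0n// mulrC -ler_pdivrMr//.
  exact/ltW/truncnS_gt.
pose n0 := (2 ^ j)%N.
have n02 : (2 <= n0)%N by rewrite /n0 expnS leq_pmulr// expn_gt0.
have Be n : (n0 <= n)%N -> `|B n| <= e.
  move=> nn; apply: le_trans (prime_harm_close HM (leq_trans n02 nn)) _.
  apply: le_trans je; rewrite ler_pM2l// lef_pV2 ?posrE ?ltr0n ?ler_nat//.
    by rewrite -(@trunc_expnK 2 j)// leq_trunc_log.
  by have [] := @trunc_log_lnln R n (leq_trans n02 nn).
pose S0 := \sum_(1 <= n < n0) `|B n|.
have S00 : 0 <= S0 by apply: sumr_ge0.
have ln0 : 0 <= ln n0%:R :> R by exact: ln_nat_ge0.
have S0l : 0 <= S0 * ln n0%:R by exact: mulr_ge0.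
(* Small enough that both [d] and the contribution S0 (1 - n0^(-d)) <= S0 d ln n0 of the indices
   below [n0] are at most e; [n0] and [S0] do not depend on [d]. *)
pose d := e / (1 + S0 * ln n0%:R).
have d0 : 0 < d by apply: divr_gt0 => //; lra.
have dE : d * (1 + S0 * ln n0%:R) = e by rewrite divfK// gt_eqF//; lra.
have de : d <= e by rewrite -dE ler_peMr ?(ltW d0)//; lra.
have dS : S0 * (1 - npow d n0) <= e.
  have h : S0 * (1 - npow d n0) <= S0 * (d * ln n0%:R).
    by rewrite ler_wpM2l//; have := @npow_ge R d n0; lra.
  by apply: le_trans h _; move: dE d0; rewrite mulrDr mulr1 mulrCA; lra.
pose r := npow d 2.
have r0 : 0 < r by exact: npow_gt0.
have dl2 : 0 < d * ln 2 by rewrite mulr_gt0//; have := @ln2_ge R; lra.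
have r1 : r < 1 by rewrite /r /npow expR_lt1; lra.
(* Up to 4d, the first two terms are the sum of p^(-1-d) over p <= N; in this form every limit in N
   is known. The -L cancels the boundary term [B 1] of the Abel summation. *)
pose X N := lncorr_sum R N - lnEuler d N - logser r (trunc_log 2 N) - L.
have Xcvg : X @ \oo --> C - - ln (zeta1 d) - - ln (1 - r) - L.
  apply: cvgB; last exact: cvg_cst.
  apply: cvgB; first by apply: cvgB; [|exact: lnEuler_cvg].
  apply: (@cvg_comp _ _ _ (trunc_log 2) (logser r)) (logser_cvg r0 r1).
  apply/cvgnyPge => A; near=> N.
  rewrite -[A](@trunc_expnK 2)// leq_trunc_log//.
  by near: N; exists (2 ^ A)%N.
have XN N : (n0 <= N)%N -> `|X N| <= 3 * e + 4 * d.
  move=> nN; have N0 : (0 < N)%N by apply: leq_trans nN; rewrite expn_gt0.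
  have w0 n : 0 <= npow d n by exact/ltW/npow_gt0.
  have w1 n : npow d n <= 1 by rewrite npow_le1// ltW.
  have wB n : (0 < n)%N -> 0 <= npow d n - npow d n.+1.
    by move=> nn; rewrite subr_ge0 npow_anti// ltW.
  have Y : \sum_(0 <= p < N.+1 | prime p) npow d p / p%:R - logser r (trunc_log 2 N) - L
     = B N * npow d N + \sum_(1 <= n < N) B n * (npow d n - npow d n.+1).
    have := @abel_sum R B (npow d) N N0; rewrite B1 npow1 mulr1 opprK => h.
    suff : \sum_(1 <= n < N) (B n.+1 - B n) * npow d n.+1 =
       \sum_(0 <= p < N.+1 | prime p) npow d p / p%:R - logser r (trunc_log 2 N).
      by move=> h'; rewrite -h' h; ring.
    rewrite -sum_prime_harm_diff//.
    have -> : logser r (trunc_log 2 N) =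
        \sum_(1 <= k < (trunc_log 2 N).+1) npow d (2 ^ k)%N / k%:R.
      by apply: eq_bigr => k _; rewrite npowX.
    rewrite -(sum_trunc_log_harm (npow d) N0) -sumrB.
    by apply: eq_bigr => n _; rewrite /B; ring.
  have h1 := @sum_npow_prime R d N (ltW d0).
  have hB : `|B N * npow d N| <= e.
    rewrite normrM (ger0_norm (w0 N)); apply: le_trans (Be N nN).
    by rewrite ler_piMr.
  (* Below [n0] each weight is at most 1 - n0^(-d), and the choice of [d] applies; from [n0] on |B
     n| <= e and the weights telescope to at most 1. *)
  have hS : `|\sum_(1 <= n < N) B n * (npow d n - npow d n.+1)| <= e + e.
    rewrite (@big_cat_nat _ _ _ n0)//=; last exact: ltnW.
    apply: le_trans (ler_normD _ _) _; apply: lerD.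
      apply: le_trans dS; rewrite /S0 big_distrl/=.
      apply: le_trans (ler_norm_sum _ _ _) _; rewrite [leLHS]big_nat [leRHS]big_nat.
      apply: ler_sum => n /andP[n1 nn0].
      rewrite normrM (ger0_norm (wB n n1)) ler_wpM2l// lerB//.
      by rewrite npow_anti// ltW.
    apply: le_trans (ler_norm_sum _ _ _) _.
    apply: (@le_trans _ _ (\sum_(n0 <= n < N) e * (npow d n - npow d n.+1))).
      rewrite [leLHS]big_nat [leRHS]big_nat; apply: ler_sum => n /andP[n1 _].
      have n1' : (0 < n)%N by apply: leq_trans n1; rewrite expn_gt0.
      by rewrite normrM (ger0_norm (wB n n1')) ler_wpM2r ?wB// Be.
    rewrite -big_distrr/= -[leRHS]mulr1 ler_wpM2l ?(ltW e0)//.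
    have -> : \sum_(n0 <= n < N) (npow d n - npow d n.+1) = npow d n0 - npow d N.
      rewrite -[RHS]opprB -(@telescope_sumr _ n0 N (npow d))// -sumrN.
      by apply: eq_bigr => n _; rewrite opprB.
    by have := w0 N; have := w1 n0; lra.
  have -> : X N = (B N * npow d N + \sum_(1 <= n < N) B n * (npow d n - npow d n.+1))
     - (\sum_(0 <= p < N.+1 | prime p) npow d p / p%:R + lnEuler d N - lncorr_sum R N).
    by rewrite -Y /X; ring.
  apply: le_trans (ler_normB _ _) _; apply: lerD => //.
  by apply: le_trans (ler_normD _ _) _; lra.
have := cvgn_norm_le Xcvg XN.
have hz := ln_zeta1 d0.
have hr := ln_1subexpR dl2.
have l2 := @ln2_le1 R.
have dl : d * ln 2 <= d by rewrite ler_piMr// ltW.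
move: hz hr; rewrite -/(npow d 2) -/r lnM ?posrE//; last first.
  by have := @ln2_ge R; lra.
rewrite /L !ler_norml => /andP[a1 a2] /andP[b1 b2] /andP[c1 c2].
by apply/andP; split; lra.
Unshelve. all: by end_near. Qed.

(** * The sum over pairs *)

Definition divsum (n : nat) : nat := (\sum_(1 <= m < n.+1) n %/ m)%N.

(** Primes range up to [x], not up to the lcm, so that the range is the same for all pairs and the
    sums can be exchanged. *)
Lemma omega_lcmn (x m n : nat) : (0 < m)%N -> (0 < n)%N -> (m * n <= x)%N ->
  omega (lcmn m n) = (\sum_(0 <= p < x.+1 | prime p) ((p %| m) || (p %| n)))%N.
Proof.
move=> m0 n0 mnx.
have l0 : (0 < lcmn m n)%N by rewrite lcmn_gt0 m0.
have pl p : prime p -> (p %| lcmn m n)%N = (p %| m)%N || (p %| n)%N.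
  move=> pp; apply/idP/orP => [pl|[h|h]].
  - apply/orP; rewrite -Euclid_dvdM//; apply: dvdn_trans pl _.
    by rewrite dvdn_lcm dvdn_mulr// dvdn_mull.
  - exact: dvdn_trans h (dvdn_lcml _ _).
  - exact: dvdn_trans h (dvdn_lcmr _ _).
rewrite /omega (@perm_size _ _ [seq p <- index_iota 0 x.+1 | prime p && (p %| lcmn m n)%N]).
  rewrite size_filter -sum1_count big_mkcond [RHS]big_mkcond; apply: eq_bigr => p _.
  by case: (boolP (prime p)) => //= pp; rewrite pl//; case: (_ || _).
apply: uniq_perm; [exact: primes_uniq|by rewrite filter_uniq// iota_uniq|move=> p].
rewrite mem_primes mem_filter mem_index_iota l0/= ltnS.
case: (boolP (prime p)) => //= pp; rewrite pl//.
case: (boolP ((p %| m) || (p %| n)))%N => //= h; apply/esym.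
case/orP: h => h; apply: leq_trans mnx; have := dvdn_leq _ h.
  by move=> /(_ m0) h1; apply: leq_trans h1 _; rewrite leq_pmulr.
by move=> /(_ n0) h1; apply: leq_trans h1 _; rewrite leq_pmull.
Qed.

Lemma count_mul_leq (x m z : nat) : (0 < m)%N -> (x %/ m <= z)%N ->
  (\sum_(1 <= n < z.+1 | m * n <= x) 1 = x %/ m)%N.
Proof.
move=> m0 xz.
rewrite (eq_bigl (fun n => true && (n < (x %/ m).+1)%N)); last first.
  by move=> n; rewrite /= ltnS leq_divRL// mulnC.
by rewrite -(@big_nat_widen _ _ _ 1 (x %/ m).+1 z.+1)// sum_nat_const_nat muln1 subn1.
Qed.

Lemma sum_dvdl (x p : nat) : (0 < p)%N ->
  (\sum_(1 <= m < x.+1) \sum_(1 <= n < x.+1 | m * n <= x) (p %| m) = divsum (x %/ p))%N.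
Proof.
move=> p0; transitivity (\sum_(1 <= m < x.+1 | p %| m) x %/ m)%N.
  rewrite [RHS]big_mkcond [LHS]big_nat [RHS]big_nat; apply: eq_bigr => m /andP[m0 _].
  case: (p %| m)%N; last by rewrite big1.
  by rewrite count_mul_leq// leq_div.
rewrite (sum_multiples x (fun m => x %/ m)%N p0) /divsum.
by apply: eq_bigr => m _; rewrite divnMA.
Qed.

Lemma sum_dvdlr (x p : nat) : (0 < p)%N ->
  (\sum_(1 <= m < x.+1) \sum_(1 <= n < x.+1 | m * n <= x) ((p %| m) && (p %| n))
   = divsum (x %/ p ^ 2))%N.
Proof.
move=> p0.
transitivity (\sum_(1 <= m < x.+1 | p %| m) \sum_(1 <= n < x.+1 | m * n <= x) (p %| n))%N.
  rewrite [RHS]big_mkcond; apply: eq_bigr => m _.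
  by case: (p %| m)%N => //; rewrite big1.
rewrite (sum_multiples x (fun m => \sum_(1 <= n < x.+1 | m * n <= x) (p %| n))%N p0).
(* After m is replaced by p m the range is m <= x / p, while [divsum (x %/ p ^ 2)] stops at x / p^2;
   the additional quotients are 0. *)
have le2 : (x %/ p ^ 2 <= x %/ p)%N by rewrite leq_div2l// expnS leq_pmulr// expn1.
rewrite /divsum [RHS](_ : _ = \sum_(1 <= m < (x %/ p).+1) x %/ p ^ 2 %/ m)%N; last first.
  rewrite [RHS](@big_cat_nat _ _ _ (x %/ p ^ 2).+1)//= [X in (_ + X)%N]big_nat.
  by rewrite [X in (_ + X)%N]big1 ?addn0// => m /andP[mm _]; rewrite divn_small.
rewrite [LHS]big_nat [RHS]big_nat; apply: eq_bigr => m /andP[m0 _].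
transitivity (\sum_(1 <= n < x.+1 | p %| n) (if p * m * n <= x then 1 else 0))%N.
  rewrite big_mkcond [RHS]big_mkcond; apply: eq_bigr => n _.
  by case: (_ <= x)%N; case: (p %| n)%N.
rewrite (sum_multiples x (fun n => if p * m * n <= x then 1 else 0)%N p0) -big_mkcond/=.
rewrite (eq_bigl (fun n => p * m * p * n <= x)%N); last first.
  by move=> n; rewrite !mulnA.
have -> : (p * m * p = p ^ 2 * m)%N by rewrite mulnAC -mulnn.
rewrite count_mul_leq ?muln_gt0 ?expn_gt0 ?p0//; first by rewrite divnMA.
by rewrite divnMA; apply: leq_trans (leq_div _ _) le2.
Qed.

(** Inclusion-exclusion prime by prime, in additive form to avoid truncated subtraction. *)
Lemma S_omegaE (x : nat) :
  (S_omega x + \sum_(0 <= p < x.+1 | prime p) divsum (x %/ p ^ 2)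
   = 2 * \sum_(0 <= p < x.+1 | prime p) divsum (x %/ p))%N.
Proof.
have -> : S_omega x = (\sum_(0 <= p < x.+1 | prime p)
   \sum_(1 <= m < x.+1) \sum_(1 <= n < x.+1 | m * n <= x) ((p %| m) || (p %| n)))%N.
  rewrite /S_omega.
  transitivity (\sum_(1 <= m < x.+1) \sum_(1 <= n < x.+1 | m * n <= x)
     \sum_(0 <= p < x.+1 | prime p) ((p %| m) || (p %| n)))%N.
    rewrite [LHS]big_nat [RHS]big_nat; apply: eq_bigr => m /andP[m0 _].
    rewrite [LHS]big_nat_cond [RHS]big_nat_cond; apply: eq_bigr => n /andP[/andP[n0 _] mnx].
    exact: omega_lcmn.
  rewrite [RHS]exchange_big/=; apply: eq_bigr => m _.
  by rewrite exchange_big.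
rewrite -big_split/= big_distrr/=; apply: eq_bigr => p pp.
have p0 := prime_gt0 pp.
rewrite mul2n -addnn -{1}(sum_dvdl x p0) -(sum_dvdl x p0) -(sum_dvdlr x p0).
rewrite [X in (_ = _ + X)%N](_ : _ =
  \sum_(1 <= m < x.+1) \sum_(1 <= n < x.+1 | m * n <= x) (p %| n))%N; last first.
  rewrite (exchange_big_dep xpredT)//=; apply: eq_bigr => m _.
  by apply: eq_bigl => n; rewrite mulnC.
rewrite -!big_split/=; apply: eq_bigr => m _; rewrite -!big_split/=.
by apply: eq_bigr => n _; case: (p %| m)%N; case: (p %| n)%N.
Qed.

(** With y = x / d and n its floor, the upper bound is n H(n) <= y (1 + ln y). For the lower one,
    floor(n / m) >= (n + 1)/m - 1; the n + 1 > y makes up for the rounding of y, and H(n) >= ln (n +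
    1) >= ln y. *)
Lemma divsum_close (R : realType) (x d : nat) : (0 < d)%N -> (d <= x)%N ->
  `|(divsum (x %/ d))%:R - x%:R / d%:R * (ln x%:R - ln d%:R)| <= x%:R / d%:R :> R.
Proof.
move=> d0 dx; have x0 : (0 < x)%N by apply: leq_trans dx.
have dR : 0 < d%:R :> R by rewrite ltr0n.
have xR : 0 < x%:R :> R by rewrite ltr0n.
rewrite -ln_div ?posrE//.
have ny := @ler_divn_nat R x d; have yn := @ltr_nat_divn R x d d0.
have n0 : (0 < x %/ d)%N by rewrite divn_gt0.
move: ny yn n0; set n := (x %/ d)%N; set y := x%:R / d%:R => ny yn n0.
have y0 : 0 < y by rewrite divr_gt0.
have nR : 1 <= n%:R :> R by rewrite ler1n.
have hi : (divsum n)%:R <= y * (1 + ln y).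
  have h1 : (divsum n)%:R <= n%:R * harm R n.
    rewrite /divsum natr_sum /harm big_distrr/=; apply: ler_sum => m _.
    exact: ler_divn_nat.
  have h2 : n%:R * harm R n <= y * (1 + ln y).
    apply: ler_pM => //.
      by apply: sumr_ge0 => m _; rewrite invr_ge0.
    apply: le_trans (harm_le R n0) _; rewrite lerD2l ler_ln ?posrE//.
    by rewrite ltr0n.
  exact: le_trans h2.
have lo : y * ln y - y <= (divsum n)%:R.
  have h1 : n.+1%:R * harm R n - n%:R <= (divsum n)%:R.
    rewrite /divsum natr_sum /harm big_distrr/=.
    have -> : n%:R = \sum_(1 <= m < n.+1) 1 :> R.
      by rewrite big_const_nat iter_addr_0 subn1.
    rewrite -sumrB [leLHS]big_nat [leRHS]big_nat; apply: ler_sum => m /andP[m0 _].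
    rewrite lerBlDr natr1 ler_pdivrMr ?ltr0n// -natrM ler_nat.
    by have := ltn_ceil n m0.
  apply: le_trans h1; apply: lerB => //.
  have ln0 : 0 <= ln y by rewrite ln_ge0//; apply: le_trans ny.
  apply: ler_pM => //; [exact: ltW|exact: ltW|].
  apply: le_trans (harm_ge R n); rewrite ler_ln ?posrE ?ltr0n//; exact: ltW.
by move: lo hi; rewrite ler_norml mulrDr mulr1 => lo hi; apply/andP; split; lra.
Qed.

Definition prime_sqr_harm (R : realType) (n : nat) : R :=
  \sum_(0 <= p < n.+1 | prime p) p%:R ^- 2.

Lemma prime_sqr_harm_cvg (R : realType) :
  exists P2 : R, forall n, (0 < n)%N -> `|prime_sqr_harm R n - P2| <= n%:R^-1.
Proof.
have [||P2 HP] := @telescope_dominated_cvg R (prime_sqr_harm R) (fun n => n%:R^-1) 1.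
- by move=> n; rewrite invr_ge0.
- move=> n n0.
  have -> : prime_sqr_harm R n.+1 - prime_sqr_harm R n =
      if prime n.+1 then n.+1%:R ^- 2 else 0.
    by rewrite /prime_sqr_harm big_mkcond big_nat_recr//= -big_mkcond addrC addrK.
  apply: le_trans (invr_sqrS_le R n0).
  by case: ifP => _; rewrite ?normr0 ?invr_ge0 ?sqr_ge0// ger0_norm// invr_ge0 sqr_ge0.
by exists P2.
Qed.

Lemma sum_divsum_prime (R : realType) (x : nat) :
  `|(\sum_(0 <= p < x.+1 | prime p) divsum (x %/ p))%N%:R
    - x%:R * (ln x%:R * prime_harm R x - prime_ln_harm R x)| <= x%:R * prime_harm R x.
Proof.
rewrite natr_sum /prime_harm /prime_ln_harm mulrBr !big_distrr/= -!sumrB.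
apply: le_trans (ler_norm_sum _ _ _) _; rewrite [leLHS]big_nat_cond [leRHS]big_nat_cond.
apply: ler_sum => p /andP[/andP[_ px] pp].
apply: le_trans (@divsum_close R x p (prime_gt0 pp) px).
by rewrite le_eqVlt; apply/orP; left; apply/eqP; congr `|_|; ring.
Qed.

(** The ln (p^2) = 2 ln p in the main terms goes into the error, since the sum of ln p / p^2 is at
    most 2; hence the 4. *)
Lemma sum_divsum_prime_sqr (R : realType) (x : nat) : (0 < x)%N ->
  `|(\sum_(0 <= p < x.+1 | prime p) divsum (x %/ p ^ 2))%N%:R
    - x%:R * (ln x%:R * prime_sqr_harm R x)| <= x%:R * (prime_sqr_harm R x + 4).
Proof.
move=> x0; have xR : 0 < x%:R :> R by rewrite ltr0n.
apply: (@le_trans _ _ (x%:R * (prime_sqr_harm R x +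
    2 * \sum_(0 <= p < x.+1 | prime p) ln p%:R / p%:R ^+ 2))); last first.
  rewrite ler_pM2l// lerD2l.
  have h : \sum_(0 <= p < x.+1 | prime p) ln p%:R / p%:R ^+ 2 <= 2 :> R.
    apply: le_trans (@sum_ln_div_sqr_le R x.+1); rewrite big_mkcond/=.
    by apply: ler_sum => p _; case: ifP => // _; rewrite divr_ge0 ?ln_nat_ge0// sqr_ge0.
  by move: h; move: (\sum_(_ <= _ < _ | _) _) => s; lra.
rewrite natr_sum /prime_sqr_harm mulrDr mulrA [2 * _]big_distrr/=.
rewrite !big_distrr/= -sumrB -big_split/=.
apply: le_trans (ler_norm_sum _ _ _) _.
apply: ler_sum => p pp; have p0 := prime_gt0 pp.
have pR : 0 < p%:R :> R by rewrite ltr0n.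
have l0 := @ln_nat_ge0 R p.
have q0 : 0 <= x%:R / p%:R ^+ 2 :> R by rewrite divr_ge0// sqr_ge0.
have -> : x%:R * p%:R ^- 2 + x%:R * (2 * (ln p%:R / p%:R ^+ 2)) =
    x%:R / p%:R ^+ 2 * (1 + 2 * ln p%:R) :> R by ring.
have -> : x%:R * ln x%:R * p%:R ^- 2 = x%:R / p%:R ^+ 2 * ln x%:R :> R by ring.
case: (leqP (p ^ 2) x) => px.
  have := @divsum_close R x (p ^ 2) _ px; rewrite expn_gt0 p0 => /(_ isT).
  rewrite natrX lnXn//.
  move: q0; move: (x%:R / p%:R ^+ 2) (ln x%:R) (ln p%:R) l0 => q a b b0 q0.
  have qb := mulr_ge0 q0 b0.
  rewrite !ler_norml mulr2n => /andP[h1 h2]; apply/andP; split; lra.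
(* For p^2 > x the divisor sum is empty, and the main term is itself an admissible error because ln
   x <= 2 ln p. *)
rewrite divn_small// /divsum big_geq// sub0r normrN ger0_norm; last first.
  by rewrite mulr_ge0// ln_nat_ge0.
rewrite ler_wpM2l//.
have : ln x%:R <= ln (p ^ 2)%:R :> R by rewrite ler_ln_nat// ltnW.
by rewrite natrX lnXn// mulr2n; lra.
Qed.

(** * The constant B and the final estimate *)

Lemma B_constE (R : realType) (M P2 : R) :
  (forall n, (2 <= n)%N -> `|prime_harm R n - ln (ln n%:R) - M| <= 11 / ln n%:R) ->
  (forall n, (0 < n)%N -> `|prime_sqr_harm R n - P2| <= n%:R^-1) ->
  B_const R = 2 * M - 2 - P2.
Proof.
move=> HM HP; have [C HC] := @lncorr_sum_cvg R.
have ME := mertens_constant HM HC.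
have HP2 : prime_sqr_harm R @ \oo --> P2.
  apply/cvgrPdist_le => e e0; near=> n; rewrite distrC.
  have n0 : (0 < n)%N by near: n; exists 1%N.
  apply: le_trans (HP n n0) _.
  rewrite -[e]invrK lef_pV2 ?posrE ?invr_gt0// ?ltr0n//.
  by near: n; exact: nbhs_infty_ger.
rewrite /B_const ME.
suff -> : \big[+%R/0]_(0 <= p <oo | prime p)
   (ln (1 - p%:R^-1) + p%:R^-1 - (2 * p%:R ^+ 2)^-1) = C - 2^-1 * P2 :> R by lra.
(* The partial sums of the infinite series run over p < n, those of [lncorr_sum] over p <= n; hence
   the shift. *)
apply: cvg_lim => //; rewrite -cvg_shiftS.
have -> : [sequence \sum_(0 <= p < n.+1 | prime p)
     (ln (1 - p%:R^-1) + p%:R^-1 - (2 * p%:R ^+ 2)^-1)]_n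
   = (fun n => lncorr_sum R n - 2^-1 * prime_sqr_harm R n).
  apply/funext => n /=; rewrite /lncorr_sum /prime_sqr_harm big_distrr/= -sumrB.
  by apply: eq_bigr => p _; rewrite invfM.
by apply: cvgB => //; apply: cvgM => //; exact: cvg_cst.
Unshelve. all: by end_near. Qed.

(** Here X, l, ll stand for x, log x, log log x, and P, T, Q for the sums of 1/p, log p / p, 1/p^2.
    The -2 in the coefficient of X l comes from replacing T by l. The errors add up to 2 X ll + (60
    + 2|M| + |P2|) X, and 70 leaves some slack. *)
Lemma main_estimate (R : realFieldType) (X l ll P T Q M P2 s1 s2 : R) :
  1 <= X -> 1 <= l -> l <= X -> 1 <= ll ->
  `|s1 - X * (l * P - T)| <= X * P -> `|s2 - X * (l * Q)| <= X * (Q + 4) ->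
  l * `|P - ll - M| <= 11 -> `|T - l| <= 5 -> X * `|Q - P2| <= 1 ->
  `|2 * s1 - s2 - (2 * X * l * ll + (2 * M - 2 - P2) * X * l)|
    <= (70 + 2 * `|M| + `|P2|) * (X * ll).
Proof.
move=> X1 l1 lX ll1 S1 S2 hP hT hQ.
have X0 : 0 <= X by lra.
have l0 : 0 <= l by lra.
have -> : 2 * s1 - s2 - (2 * X * l * ll + (2 * M - 2 - P2) * X * l) =
  2 * (s1 - X * (l * P - T)) - (s2 - X * (l * Q)) + 2 * X * (l * (P - ll - M))
  - 2 * X * (T - l) - X * (Q - P2) * l by ring.
have hl : `|X * (Q - P2) * l| <= X.
  rewrite !normrM (ger0_norm X0) (ger0_norm l0); apply: le_trans lX.
  by rewrite ler_piMl.
have hT' : `|2 * X * (T - l)| <= 10 * X.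
  rewrite normrM ger0_norm; last lra.
  have : X * `|T - l| <= X * 5 by rewrite ler_wpM2l.
  by lra.
have hP' : `|2 * X * (l * (P - ll - M))| <= 22 * X.
  rewrite normrM [X in _ * X]normrM (ger0_norm l0) ger0_norm; last lra.
  have : X * (l * `|P - ll - M|) <= X * 11 by rewrite ler_wpM2l.
  by lra.
have hs1 : `|2 * (s1 - X * (l * P - T))| <= 2 * (X * P).
  by rewrite normrM ger0_norm// ler_pM2l.
have PB : P <= ll + `|M| + 11.
  have h1 : `|P - ll - M| <= 11 by apply: le_trans hP; rewrite ler_peMl.
  have := ler_norm (P - ll - M); have := ler_norm M; lra.
have QB : Q <= `|P2| + 1.
  have h1 : `|Q - P2| <= 1 by apply: le_trans hQ; rewrite ler_peMl.
  have := ler_norm (Q - P2); have := ler_norm P2; lra.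
have XP : X * P <= X * (ll + `|M| + 11) by rewrite ler_wpM2l.
have XQ : X * (Q + 4) <= X * (`|P2| + 1 + 4) by rewrite ler_wpM2l// lerD2r.
have fin : X * (2 * `|M| + `|P2| + 60) <= X * (2 * `|M| + `|P2| + 60) * ll.
  by rewrite ler_peMr// mulr_ge0// !addr_ge0// mulr_ge0.
have XL : 0 <= X * ll by rewrite mulr_ge0//; lra.
apply: le_trans (ler_normB _ _) _.
apply: (@le_trans _ _ (2 * (X * P) + X * (Q + 4) + 22 * X + 10 * X + X)); last first.
  by move: (`|M|) (`|P2|) XP XQ fin => m p2 XP XQ fin; lra.
apply: lerD => //; apply: le_trans (ler_normB _ _) _; apply: lerD => //.
apply: le_trans (ler_normD _ _) _; apply: lerD => //.
by apply: le_trans (ler_normB _ _) _; apply: lerD.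
Qed.

Theorem theorem1p2 (R : realType) :
  (fun x : nat => (S_omega x)%:R : R) =
  (fun x : nat => 2 * x%:R * ln x%:R * ln (ln x%:R) + B_const R * x%:R * ln x%:R)
  +O_\oo (fun x : nat => x%:R * ln (ln x%:R)).
Proof.
have [M HM] := @mertens_second R.
have [P2 HP] := @prime_sqr_harm_cvg R.
rewrite (B_constE HM HP).
pose K : R := 70 + 2 * `|M| + `|P2|.
apply/eqaddOP; near=> k; near=> x.
have x2 : (2 <= x)%N by near: x; exists 2%N.
have x0 : (0 < x)%N by apply: leq_trans x2.
have xR : 1 <= x%:R :> R by rewrite ler1n.
(* From e^e on, log log x >= 1, so that errors of order x are absorbed into x log log x. *)
have xee : expR (expR 1) <= x%:R :> R by near: x; exact: nbhs_infty_ger.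
have e1 : 1 <= expR 1 :> R by have := @expR_ge1Dx R 1; lra.
have l1 : expR 1 <= ln x%:R :> R.
  by rewrite -[leLHS]expRK ler_ln ?posrE ?expR_gt0//; lra.
have ll1 : 1 <= ln (ln x%:R) :> R.
  by rewrite -[leLHS]expRK ler_ln ?posrE ?expR_gt0//; lra.
have kK : K <= k by near: k; apply: nbhs_pinfty_ge; exact: num_real.
have hx : `|x%:R * ln (ln x%:R)| = x%:R * ln (ln x%:R) :> R.
  by rewrite ger0_norm// mulr_ge0//; lra.
rewrite hx.
have S1 := @sum_divsum_prime R x.
have S2 := @sum_divsum_prime_sqr R x x0.
have SE : (S_omega x)%:R = 2 * (\sum_(0 <= p < x.+1 | prime p) divsum (x %/ p))%N%:R
   - (\sum_(0 <= p < x.+1 | prime p) divsum (x %/ p ^ 2))%N%:R :> R.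
  by have := congr1 (fun n => n%:R : R) (S_omegaE x); rewrite natrD natrM; lra.
have H1 := HM x x2.
have H2 := @mertens_first R x x0.
have H3 := HP x x0.
have lx : ln x%:R <= x%:R :> R by apply/ltW/ln_sublinear; lra.
have H1' : ln x%:R * `|prime_harm R x - ln (ln x%:R) - M| <= 11.
  by rewrite mulrC -ler_pdivlMr//; lra.
have H3' : x%:R * `|prime_sqr_harm R x - P2| <= 1.
  by rewrite mulrC -ler_pdivlMr ?mul1r//; lra.
rewrite -[X in `|X|]/((S_omega x)%:R - (2 * x%:R * ln x%:R * ln (ln x%:R) +
  (2 * M - 2 - P2) * x%:R * ln x%:R)) SE.
apply: le_trans (ler_wpM2r _ kK); last by rewrite mulr_ge0//; lra.
move: S1 S2; set s1 := (\sum_(_ <= _ < _ | _) divsum (x %/ _))%N%:R.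
set s2 := (\sum_(_ <= _ < _ | _) divsum (x %/ _ ^ 2))%N%:R => S1 S2.
exact: main_estimate xR (le_trans e1 l1) lx ll1 S1 S2 H1' H2 H3'.
Unshelve. all: by end_near. Qed.
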